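(* Assume the axiom of determinacy ($\mathsf{AD}$). Suppose that $Y$ is an analytic Hausdorff space, $H$ is a box-open $\mathbb{N}$-dimensional dihypergraph on $Y$, and $X\subseteq Y$. Then exactly one of the following holds: (1) there is an $\aleph_0$-coloring of $H\upharpoonright X$; (2) there is a continuous homomorphism from $\mathbb{H}_{\mathbb{N}^{\mathbb{N}}}$ to $H\upharpoonright X$.
   Context: Base theory: $\mathsf{ZF}+\mathsf{DC}$ (together with the hypothesis $\mathsf{AD}$). A topological space is analytic if it is a continuous image of a closed subset of $\mathbb{N}^{\mathbb{N}}$. An $\mathbb{N}$-dimensional dihypergraph on $Y$ is a subset $H$ of $Y^{\mathbb{N}}$ containing no constant sequence. It is box-open if it is open in the box topology on $Y^{\mathbb{N}}$, i.e., the topology generated by the sets $\prod_{n\in\mathbb{N}}U_n$ with every $U_n\subseteq Y$ open. $H\upharpoonright X=H\cap X^{\mathbb{N}}$, viewed as a dihypergraph on the subspace $X$. A homomorphism from $R\subseteq Z^{\mathbb{N}}$ to $S\subseteq W^{\mathbb{N}}$ is a map $\pi\colon Z\to W$ such that $(\pi(z_n))_{n}\in S$ for all $(z_n)_n\in R$. An $\aleph_0$-coloring of a dihypergraph is a homomorphism from it to the complete dihypergraph (all non-constant sequences) on a set of cardinality $\aleph_0$, i.e., a map that is non-constant along every element of the dihypergraph. For $t\in\mathbb{N}^{<\mathbb{N}}$ (finite sequences), $\mathcal{N}_t=\{b\in\mathbb{N}^{\mathbb{N}} : t\sqsubseteq b\}$, and $t\cdot(n)$ is $t$ followed by the single entry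 $n$. $\mathbb{H}_{\mathbb{N}^{\mathbb{N}}}=\bigcup_{t\in\mathbb{N}^{<\mathbb{N}}}\prod_{n\in\mathbb{N}}\mathcal{N}_{t\cdot(n)}$, an $\mathbb{N}$-dimensional dihypergraph on $\mathbb{N}^{\mathbb{N}}$. *)

(* Defs.v *)
(* AD contradicts the axiom of choice, so a theorem of ZF + DC + AD would be
   vacuous if "set" were read as "Rocq type" or "Rocq predicate" next to a
   choice principle such as constructive_indefinite_description.  It is
   therefore read as what it says: a sentence true in every model V of the
   first-order theory ZF + DC + AD.  Every set, function, space, strategy, etc.
   below is an element of V, and all quantifiers range over V.  Choice in the
   metatheory says nothing about choice in V, because Separation and
   Replacement are only assumed for first-order formulas. *)

Set Implicit Arguments.
Unset Strict Implicit.

Record set_structure : Type := SetStructure {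
  carrier :> Type;
  mem : carrier -> carrier -> Prop
}.

Declare Scope set_theory_scope.
Delimit Scope set_theory_scope with st.
Notation "x ∈ a" := (mem x a) (at level 70, no associativity) : set_theory_scope.
Local Open Scope set_theory_scope.

(* The classes used below are all first-order definable over V.  They are never
   quantified over: they only occur as abbreviations, or as parameters that get
   instantiated by sets and by definable classes. *)
Definition class (V : set_structure) : Type := V -> Prop.
Definition elements (V : set_structure) (a : V) : class V := fun x => x ∈ a.
Coercion elements : carrier >-> class.

(* a = { z | P z } *)
Definition is_set_of (V : set_structure) (a : V) (P : class V) : Prop :=
  forall z, z ∈ a <-> P z.

Definition included (V : set_structure) (A B : class V) : Prop :=
  forall z, A z -> B z.

(** * First-order formulas of the language of set theory *)

(* De Bruijn indices: an assignment is a map nat -> V, and a quantifier binds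
   the variable 0 and shifts the others. *)
Inductive formula : Type :=
| FMem (i j : nat)
| FEq (i j : nat)
| FFalse
| FAnd (p q : formula)
| FOr (p q : formula)
| FImp (p q : formula)
| FAll (p : formula)
| FEx (p : formula).

Definition scons (T : Type) (x : T) (e : nat -> T) : nat -> T :=
  fun n => match n with O => x | S m => e m end.

Fixpoint sat (V : set_structure) (e : nat -> V) (p : formula) : Prop :=
  match p with
  | FMem i j => e i ∈ e j
  | FEq i j => e i = e j
  | FFalse => False
  | FAnd p q => sat e p /\ sat e q
  | FOr p q => sat e p \/ sat e q
  | FImp p q => sat e p -> sat e q
  | FAll p => forall x : V, sat (scons x e) p
  | FEx p => exists x : V, sat (scons x e) p
  end.

(** * Elementary set theory in V *)

Section Elementary.
Variable V : set_structure.
Implicit Types a b f g k n p s t x y z I O U : V.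
Implicit Types A B C D F : class V.

Definition is_empty a := is_set_of a (fun _ => False).
Definition is_upair p x y := is_set_of p (fun z => z = x \/ z = y).
Definition is_union U F := is_set_of U (fun z => exists a, F a /\ z ∈ a).
Definition is_succ s n := is_set_of s (fun z => z ∈ n \/ z = n).

(* p = (x, y), Kuratowski *)
Definition is_opair p x y :=
  exists s t, is_upair s x x /\ is_upair t x y /\ is_upair p s t.

Definition is_inductive I :=
  (exists z, is_empty z /\ z ∈ I) /\
  (forall n, n ∈ I -> exists s, is_succ s n /\ s ∈ I).

(* The von Neumann natural numbers of V, possibly nonstandard. *)
Definition omega : class V := fun n => forall I, is_inductive I -> n ∈ I.

(* (x, y) ∈ f *)
Definition maps f x y := exists p, is_opair p x y /\ p ∈ f.

Definition is_fun f A B :=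
  (forall p, p ∈ f -> exists x y, A x /\ B y /\ is_opair p x y) /\
  (forall x, A x -> exists! y, maps f x y).

Definition injective_on f A :=
  forall x x' y, A x -> A x' -> maps f x y -> maps f x' y -> x = x'.
Definition surjective_onto f A B :=
  forall y, B y -> exists x, A x /\ maps f x y.

(* h = g ∘ f *)
Definition is_comp h g f :=
  is_set_of h (fun p => exists x y z, maps f x y /\ maps g y z /\ is_opair p x z).

Definition countably_infinite C :=
  exists g, is_fun g omega C /\ injective_on g omega /\ surjective_onto g omega C.

(* A^ℕ *)
Definition seqs A : class V := fun s => is_fun s omega A.

Definition baire : class V := seqs omega.

(* A natural number k is the set of its predecessors, so that functions from k
   are the sequences of length k. *)
Definition finseq_of_length t k := omega k /\ is_fun t k omega.
Definition finseq : class V := fun t => exists k, finseq_of_length t k.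

(* t' = t · (n) *)
Definition is_snoc t' t n :=
  exists k p, finseq_of_length t k /\ is_opair p k n /\
    is_set_of t' (fun z => z ∈ t \/ z = p).

(* 𝒩_t; extension of sequences is inclusion of graphs *)
Definition cylinder t : class V := fun b => baire b /\ included t b.

End Elementary.

Arguments omega {V}.
Arguments baire {V}.
Arguments finseq {V}.

(** * ZF, DC and AD *)

Section Theory.
Variable V : set_structure.
Implicit Types a b f i n t u x y z I A R : V.

Record ZF : Prop := {
  zf_extensionality : forall a b, (forall z, z ∈ a <-> z ∈ b) -> a = b;
  zf_foundation : forall a, (exists z, z ∈ a) ->
    exists z, z ∈ a /\ ~ exists x, x ∈ z /\ x ∈ a;
  zf_pairing : forall x y, exists a, is_upair a x y;
  zf_union : forall a, exists u, is_union u a;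
  zf_power : forall a, exists b, is_set_of b (fun x => included x a);
  zf_infinity : exists I, is_inductive I;
  zf_separation : forall (p : formula) (e : nat -> V) a,
    exists b, is_set_of b (fun x => x ∈ a /\ sat (scons x e) p);
  zf_replacement : forall (p : formula) (e : nat -> V) a,
    (forall x, x ∈ a -> exists! y, sat (scons y (scons x e)) p) ->
    exists b, is_set_of b (fun y => exists x, x ∈ a /\ sat (scons y (scons x e)) p)
}.

Definition DC : Prop :=
  forall A R, (exists x, x ∈ A) ->
    (forall x, x ∈ A -> exists y, y ∈ A /\ maps R x y) ->
    exists f, is_fun f omega A /\
      forall n n' x y, omega n -> is_succ n' n ->
        maps f n x -> maps f n' y -> maps R x y.

Definition even : class V := fun n =>
  omega n /\
  forall I, (forall z, is_empty z -> z ∈ I) ->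
    (forall m m' m'', m ∈ I -> is_succ m' m -> is_succ m'' m' -> m'' ∈ I) ->
    n ∈ I.
Definition odd : class V := fun n => omega n /\ ~ even n.

Definition is_strategy f : Prop := is_fun f finseq omega.

(* The move b(n) is the one that the strategy f prescribes at b↾n. *)
Definition obeys_at f b n : Prop :=
  forall t i, finseq_of_length t n -> included t b -> maps f t i -> maps b n i.

(* In the game on A the players choose b(0), b(1), ... in turn, and I, who
   chooses the b(n) with n even, wins if b ∈ A. *)
Definition winning_for_I f A : Prop :=
  is_strategy f /\
  forall b, baire b -> (forall n, even n -> obeys_at f b n) -> b ∈ A.
Definition winning_for_II f A : Prop :=
  is_strategy f /\
  forall b, baire b -> (forall n, odd n -> obeys_at f b n) -> ~ b ∈ A.

Definition AD : Prop :=
  forall A, included A baire ->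
    (exists f, winning_for_I f A) \/ (exists f, winning_for_II f A).

End Theory.

(** * Topology in V *)

Section Topology.
Variable V : set_structure.
Implicit Types a b f t x y z O P S U W Y TY : V.
Implicit Types A B T G : class V.

(* T is the class of open sets. *)
Definition is_topology A T : Prop :=
  (forall O, T O -> included O A) /\
  (forall O, is_set_of O A -> T O) /\
  (forall S U : V, included S T -> is_union U S -> T U) /\
  (forall O U W, T O -> T U -> is_set_of W (fun z => z ∈ O /\ z ∈ U) -> T W).

(* The topology on A generated by G: the least one whose open sets include the
   sets in G. *)
Definition generated_topology A G : class V := fun O =>
  forall S : V, is_topology A S -> included G S -> O ∈ S.

Definition subspace_topology T A : class V := fun O =>
  exists U, T U /\ is_set_of O (fun z => z ∈ U /\ A z).

Definition continuous A (TA TB : class V) f : Prop :=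
  forall O, TB O ->
    exists P, TA P /\ is_set_of P (fun x => A x /\ exists y, y ∈ O /\ maps f x y).

Definition hausdorff Y TY : Prop :=
  forall x y, x ∈ Y -> y ∈ Y -> x <> y ->
    exists U W, U ∈ TY /\ W ∈ TY /\ x ∈ U /\ y ∈ W /\ ~ exists z, z ∈ U /\ z ∈ W.

Definition baire_topology : class V :=
  generated_topology baire
    (fun O => exists t, finseq t /\ is_set_of O (cylinder t)).

Definition closed_in_baire A : Prop :=
  included A baire /\
  exists O, baire_topology O /\ is_set_of O (fun b => baire b /\ ~ A b).

Definition analytic Y TY : Prop :=
  exists C f : V, closed_in_baire C /\
    is_fun f C Y /\ surjective_onto f C Y /\
    continuous C (subspace_topology baire_topology C) TY f.

End Topology.

Arguments baire_topology {V}.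

(** * ℕ-dimensional dihypergraphs in V *)

Section Dihypergraphs.
Variable V : set_structure.
Implicit Types B c f h n s t u x y z O X Y TY : V.
Implicit Types A H R S Z W : class V.

Definition is_constant s : Prop := exists x, forall n, omega n -> maps s n x.

Definition dihypergraph H A : Prop :=
  included H (seqs A) /\ forall h, H h -> ~ is_constant h.

(* B = ∏_n u(n), where u is a sequence of open subsets of Y *)
Definition is_open_box Y TY B : Prop :=
  exists u, is_fun u omega TY /\
    is_set_of B (fun s => seqs Y s /\
      forall n O x, maps u n O -> maps s n x -> x ∈ O).

Definition box_open Y TY : class V :=
  generated_topology (seqs Y) (is_open_box Y TY).

Definition restriction H A : class V := fun h => H h /\ seqs A h.

Definition homomorphism Z R W S f : Prop :=
  is_fun f Z W /\
  forall z, R z -> exists s, is_comp s f z /\ S s.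

Definition complete_dihypergraph A : class V :=
  fun s => seqs A s /\ ~ is_constant s.

(* There is an ℵ₀-coloring of the dihypergraph R on Z. *)
Definition aleph0_colorable Z R : Prop :=
  exists C c : V, countably_infinite C /\
    homomorphism Z R C (complete_dihypergraph C) c.

(* ⋃_t ∏_n 𝒩_{t·(n)} *)
Definition baire_dihypergraph : class V := fun z =>
  exists t, finseq t /\ seqs baire z /\
    forall n b t', maps z n b -> is_snoc t' t n -> cylinder t' b.

(* There is a continuous homomorphism from baire_dihypergraph to H↾X. *)
Definition continuous_homomorphism_into TY H X : Prop :=
  exists f, homomorphism baire baire_dihypergraph X (restriction H X) f /\
    continuous baire baire_topology (subspace_topology TY X) f.

End Dihypergraphs.

(* Main.v *)
(* An integer game is played on a continuous surjection f : C -> Y with C a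
   subset of Baire space. In each round player I plays (a code of) a finite
   sequence t and player II accepts or rejects it. If infinitely many rounds are
   accepted, player I wins when the union x of the accepted sequences lies in C
   and f(x) in X; otherwise player I wins when the sequences t_0, t_1, ... played
   after the last accepted round satisfy prod_n f[N_{t_n}] included in H.

   A strategy for player I turns z into the play in which player II rejects z(0)
   times, accepts, rejects z(1) times, accepts, ...; the map z |-> f(x) is then a
   continuous homomorphism, because the play in which player II rejects forever
   shows that the sequences available after a position span a box inside H.

   Given a winning strategy of player II, every x with f(x) in X has a position
   that is stuck: it accepts only initial segments of x, and no longer position
   accepts more of x in this sense, for otherwise player II would lose the play
   converging to x. The points stuck at a position p have no edge between
   their images: otherwise player I could play, from p on, the box of
   neighbourhoods of such an edge, of which nothing is ever accepted, and would
   win. There are only countably many positions, hence a coloring. *)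

From Stdlib Require Import Classical ClassicalEpsilon.
Require Import Defs.

Set Implicit Arguments.
Unset Strict Implicit.
Local Open Scope set_theory_scope.
Existing Class ZF.

(** * Definability with parameters *)

(** [V] satisfies Separation only for first-order formulas, so every set formed below needs a proof
    that its defining condition is definable with parameters; [dfn] and [dfnt] carry this proof
    along. The choice operator of the metatheory only names sets whose existence is already proved
    in [V]. AD concerns games with integer moves, while the sides of a box in [Y] need not have
    integer codes. The surjection [f] bridges this gap: finite sequences code images of cylinders,
    and continuity makes such images fit into a given open set. The payoff set may be as complicated
    as [X] is, since AD determines all integer games. That the alternatives exclude each other is a
    diagonal argument. If a colour occurred in every child cylinder of a node, countable choice
    would pick a branch of that colour in each child, and these branches would form an edge whose
    image has a constant colour. So below every node each colour can be avoided by passing to a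
    suitable child; avoiding all colours in turn leads to a branch that has none. *)

Section Definability.
Variable V : set_structure.
Implicit Types (e : nat -> V) (p q : formula).

Definition up (g : nat -> nat) (i : nat) : nat :=
  match i with O => O | S j => S (g j) end.

Fixpoint ren (g : nat -> nat) (p : formula) : formula :=
  match p with
  | FMem i j => FMem (g i) (g j)
  | FEq i j => FEq (g i) (g j)
  | FFalse => FFalse
  | FAnd p q => FAnd (ren g p) (ren g q)
  | FOr p q => FOr (ren g p) (ren g q)
  | FImp p q => FImp (ren g p) (ren g q)
  | FAll p => FAll (ren (up g) p)
  | FEx p => FEx (ren (up g) p)
  end.

Lemma sat_ext p e e' : (forall i, e i = e' i) -> (sat e p <-> sat e' p).
Proof.
revert e e'; induction p; simpl; intros e e' E.
- now rewrite !E.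
- now rewrite !E.
- tauto.
- now rewrite (IHp1 _ _ E), (IHp2 _ _ E).
- now rewrite (IHp1 _ _ E), (IHp2 _ _ E).
- now rewrite (IHp1 _ _ E), (IHp2 _ _ E).
- assert (K : forall x, sat (scons x e) p <-> sat (scons x e') p)
    by (intros x; apply IHp; intros [|i]; simpl; auto).
  now split; intros H x; apply K.
- assert (K : forall x, sat (scons x e) p <-> sat (scons x e') p)
    by (intros x; apply IHp; intros [|i]; simpl; auto).
  now split; intros [x H]; exists x; apply K.
Qed.

Lemma sat_ren p g e : sat e (ren g p) <-> sat (fun i => e (g i)) p.
Proof.
revert g e; induction p; simpl; intros g e; try tauto.
- now rewrite IHp1, IHp2.
- now rewrite IHp1, IHp2.
- now rewrite IHp1, IHp2.
- assert (K : forall x, sat (scons x e) (ren (up g) p)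
      <-> sat (scons x (fun i => e (g i))) p).
  { intros x; rewrite IHp; apply sat_ext; now intros [|i]. }
  now split; intros H x; apply K.
- assert (K : forall x, sat (scons x e) (ren (up g) p)
      <-> sat (scons x (fun i => e (g i))) p).
  { intros x; rewrite IHp; apply sat_ext; now intros [|i]. }
  now split; intros [x H]; exists x; apply K.
Qed.

(* A variable of the formula stands for a variable of the environment or for a
   parameter. *)
Definition val e (r : nat + V) : V := match r with inl i => e i | inr c => c end.

Definition dfn (A : (nat -> V) -> Prop) : Prop :=
  exists p (r : nat -> nat + V),
    forall e, sat (fun i => val e (r i)) p <-> A e.

(* The graph of [t], whose value is the variable 0. *)
Definition dfnt (t : (nat -> V) -> V) : Prop :=
  dfn (fun e => e 0 = t (fun i => e (S i))).

Lemma dfn_ext (A B : (nat -> V) -> Prop) :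
  (forall e, A e <-> B e) -> dfn A -> dfn B.
Proof.
intros AB [p [r H]]; exists p, r; intros e; now rewrite H.
Qed.

(** Two formulas come with unrelated variable assignments. Giving the even variables to one and the
    odd variables to the other merges them into a single assignment. *)
Definition interleave (T : Type) (r s : nat -> T) (i : nat) : T :=
  if Nat.even i then r (Nat.div2 i) else s (Nat.div2 i).

Lemma interleave_even T (r s : nat -> T) i : interleave r s (2 * i) = r i.
Proof. now unfold interleave; rewrite PeanoNat.Nat.even_even, PeanoNat.Nat.div2_double. Qed.

Lemma interleave_odd T (r s : nat -> T) i : interleave r s (S (2 * i)) = s i.
Proof.
unfold interleave; rewrite PeanoNat.Nat.div2_succ_double.
replace (S (2 * i)) with (2 * i + 1) by now rewrite PeanoNat.Nat.add_1_r.
now rewrite PeanoNat.Nat.even_odd.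
Qed.

Lemma dfn_bin (F : formula -> formula -> formula) (op : Prop -> Prop -> Prop)
  (A B : (nat -> V) -> Prop) :
  (forall e p q, sat e (F p q) <-> op (sat e p) (sat e q)) ->
  (forall a b a' b', (a <-> a') -> (b <-> b') -> (op a b <-> op a' b')) ->
  dfn A -> dfn B -> dfn (fun e => op (A e) (B e)).
Proof.
intros HF Hop [p [r HA]] [q [s HB]].
exists (F (ren (fun i => 2 * i) p) (ren (fun i => S (2 * i)) q)), (interleave r s).
intros e; rewrite HF; apply Hop; rewrite sat_ren.
- rewrite <- HA; apply sat_ext; intros i; now rewrite interleave_even.
- rewrite <- HB; apply sat_ext; intros i; now rewrite interleave_odd.
Qed.

Lemma dfn_and (A B : (nat -> V) -> Prop) :
  dfn A -> dfn B -> dfn (fun e => A e /\ B e).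
Proof. now apply (@dfn_bin FAnd and); simpl; [tauto | intros a b a' b' -> ->]. Qed.

Lemma dfn_or (A B : (nat -> V) -> Prop) :
  dfn A -> dfn B -> dfn (fun e => A e \/ B e).
Proof. now apply (@dfn_bin FOr or); simpl; [tauto | intros a b a' b' -> ->]. Qed.

Lemma dfn_imp (A B : (nat -> V) -> Prop) :
  dfn A -> dfn B -> dfn (fun e => A e -> B e).
Proof.
now apply (@dfn_bin FImp (fun a b => a -> b)); simpl;
  [tauto | intros a b a' b' -> ->].
Qed.

(** A proposition that does not mention the environment is true or false, so a trivially true or a
    trivially false formula expresses it. *)
Lemma dfn_const (P : Prop) : dfn (fun _ => P).
Proof.
destruct (classic P) as [H | H].
- exists (FImp FFalse FFalse), inl; simpl; tauto.
- exists FFalse, inl; simpl; tauto.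
Qed.

Lemma dfn_not (A : (nat -> V) -> Prop) : dfn A -> dfn (fun e => ~ A e).
Proof. now intros H; apply dfn_imp, dfn_const. Qed.

Lemma dfn_iff (A B : (nat -> V) -> Prop) :
  dfn A -> dfn B -> dfn (fun e => A e <-> B e).
Proof. now intros HA HB; apply dfn_and; apply dfn_imp. Qed.

(** Several variables of the formula may stand for the variable that gets bound. All of them become
    variable 0; every other variable [i] becomes [S i] and keeps its meaning in the outer
    environment. *)
Definition bind_var (r : nat -> nat + V) (i : nat) : nat :=
  match r i with inl O => 0 | _ => S i end.
Definition bind_env (r : nat -> nat + V) (i : nat) : nat + V :=
  match r i with inl (S j) => inl j | s => s end.

Lemma sat_bind p (r : nat -> nat + V) e x :
  sat (scons x (fun i => val e (bind_env r i))) (ren (bind_var r) p) <->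
  sat (fun i => val (scons x e) (r i)) p.
Proof.
rewrite sat_ren; apply sat_ext; intros i; unfold bind_var, bind_env.
now destruct (r i) as [[|j]|c] eqn:E; simpl; try rewrite E.
Qed.

(* Under a binder the bound variable is [e 0] and the outer environment is
   [fun i => e (S i)]. *)
Lemma dfn_all (B : (nat -> V) -> V -> Prop) :
  dfn (fun e => B (fun i => e (S i)) (e 0)) -> dfn (fun e => forall x, B e x).
Proof.
intros [p [r H]]; exists (FAll (ren (bind_var r) p)), (bind_env r); intros e; simpl.
now split; intros K x; specialize (K x); apply sat_bind in K || apply sat_bind;
  apply (H (scons x e)) in K || apply (H (scons x e)).
Qed.

Lemma dfn_ex (B : (nat -> V) -> V -> Prop) :
  dfn (fun e => B (fun i => e (S i)) (e 0)) -> dfn (fun e => exists x, B e x).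
Proof.
intros [p [r H]]; exists (FEx (ren (bind_var r) p)), (bind_env r); intros e; simpl.
split; intros [x K]; exists x.
- now apply sat_bind, (H (scons x e)) in K.
- now apply sat_bind, (H (scons x e)).
Qed.

Lemma dfn_ren (A : (nat -> V) -> Prop) (g : nat -> nat) :
  dfn A -> dfn (fun e => A (fun i => e (g i))).
Proof.
intros [p [r H]].
exists p, (fun i => match r i with inl j => inl (g j) | inr c => inr c end).
intros e; rewrite <- H; apply sat_ext; intros i; now destruct (r i).
Qed.

Lemma dfn_up (A : (nat -> V) -> V -> Prop) (g : nat -> nat) :
  dfn (fun e => A (fun i => e (S i)) (e 0)) ->
  dfn (fun e => A (fun i => e (S (g i))) (e 0)).
Proof. exact (dfn_ren (up g)). Qed.

Lemma dfn_eq_var i j : dfn (fun e => e i = e j).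
Proof. now exists (FEq i j), inl. Qed.

Lemma dfn_mem_var i j : dfn (fun e => e i ∈ e j).
Proof. now exists (FMem i j), inl. Qed.

Lemma dfnt_var i : dfnt (fun e => e i).
Proof. exact (dfn_eq_var 0 (S i)). Qed.

Lemma dfnt_const c : dfnt (fun _ => c).
Proof.
exists (FEq 0 1), (fun i => match i with O => inl 0 | _ => inr c end).
now intros e.
Qed.

Lemma dfnt_ren (t : (nat -> V) -> V) (g : nat -> nat) :
  dfnt t -> dfnt (fun e => t (fun i => e (g i))).
Proof. exact (@dfn_up (fun e x => x = t e) g). Qed.

(** The language has no function symbols, so the value of the term is named by a quantified
    variable. *)
Lemma dfn_subst (A : (nat -> V) -> V -> Prop) (t : (nat -> V) -> V) :
  dfn (fun e => A (fun i => e (S i)) (e 0)) -> dfnt t -> dfn (fun e => A e (t e)).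
Proof.
intros HA Ht; apply (@dfn_ext (fun e => exists x, x = t e /\ A e x)).
- intros e; split; [now intros [x [-> H]] | intros H; now exists (t e)].
- now apply dfn_ex, dfn_and.
Qed.

Lemma dfn_ren1 (A : (nat -> V) -> V -> Prop) (g : nat -> nat) (t : (nat -> V) -> V) :
  dfn (fun e => A (fun i => e (S i)) (e 0)) -> dfnt t ->
  dfn (fun e => A (fun i => e (g i)) (t e)).
Proof.
intros HA; apply (@dfn_subst (fun e x => A (fun i => e (g i)) x)).
exact (dfn_up g HA).
Qed.

Lemma dfn_ren2 (A : (nat -> V) -> V -> V -> Prop) (g : nat -> nat)
  (s t : (nat -> V) -> V) :
  dfn (fun e => A (fun i => e (S (S i))) (e 1) (e 0)) -> dfnt s -> dfnt t ->
  dfn (fun e => A (fun i => e (g i)) (s e) (t e)).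
Proof.
intros HA Hs Ht.
apply (@dfn_subst (fun e x => A (fun i => e (g i)) (s e) x)); [|exact Ht].
apply (@dfn_subst (fun e y => A (fun i => e (S (g i))) y (e 0)));
  [|exact (dfnt_ren S Hs)].
(* The value of [t] was introduced before that of [s], so the variables 0 and 1 have to be
   exchanged. *)
exact (@dfn_ren (fun e => A (fun i => e (S (S i))) (e 1) (e 0))
  (fun i => match i with O => 1 | S O => 0 | S (S j) => S (S (g j)) end) HA).
Qed.

Lemma dfnt_ren1 (f : (nat -> V) -> V -> V) (g : nat -> nat) (t : (nat -> V) -> V) :
  dfnt (fun e => f (fun i => e (S i)) (e 0)) -> dfnt t ->
  dfnt (fun e => f (fun i => e (g i)) (t e)).
Proof.
intros Hf Ht.
apply (@dfn_ren2 (fun e x y => y = f e x) (fun i => S (g i))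
  (fun e => t (fun i => e (S i))) (fun e => e 0)); try apply dfnt_var.
- exact Hf.
- exact (dfnt_ren S Ht).
Qed.

Lemma dfnt_ren2 (f : (nat -> V) -> V -> V -> V) (g : nat -> nat)
  (s t : (nat -> V) -> V) :
  dfnt (fun e => f (fun i => e (S (S i))) (e 1) (e 0)) -> dfnt s -> dfnt t ->
  dfnt (fun e => f (fun i => e (g i)) (s e) (t e)).
Proof.
intros Hf Hs Ht.
apply (@dfn_subst (fun e y => e 0 = f (fun i => e (S (g i))) (s (fun i => e (S i))) y));
  [|exact (dfnt_ren S Ht)].
apply (@dfn_ren2 (fun e x y => e 0 = f (fun i => e (S i)) x y)
  (fun i => match i with O => 1 | S j => S (S (g j)) end)
  (fun e => s (fun i => e (S (S i)))) (fun e => e 0)); try apply dfnt_var.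
- exact (@dfn_ren (fun e => e 0 = f (fun i => e (S (S (S i)))) (e 2) (e 1))
  (fun i => match i with O => 2 | S O => 0 | S (S O) => 1 | S (S (S j)) => S (S (S j)) end) Hf).
- exact (dfnt_ren (fun i => S (S i)) Hs).
Qed.

Lemma dfn_mem (s t : (nat -> V) -> V) :
  dfnt s -> dfnt t -> dfn (fun e => s e ∈ t e).
Proof. exact (@dfn_ren2 (fun _ x y => x ∈ y) S s t (dfn_mem_var 1 0)). Qed.

Lemma dfn_eq (s t : (nat -> V) -> V) :
  dfnt s -> dfnt t -> dfn (fun e => s e = t e).
Proof. exact (@dfn_ren2 (fun _ x y => x = y) S s t (dfn_eq_var 1 0)). Qed.

Lemma dfn_elements (s t : (nat -> V) -> V) :
  dfnt s -> dfnt t -> dfn (fun e => elements (t e) (s e)).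
Proof. exact (@dfn_mem s t). Qed.

Lemma dfn_ex_unique (B : (nat -> V) -> V -> Prop) :
  dfn (fun e => B (fun i => e (S i)) (e 0)) -> dfn (fun e => exists! x, B e x).
Proof.
intros H; apply (@dfn_ex (fun e x => B e x /\ forall y, B e y -> x = y)).
apply dfn_and; [exact H|].
apply (@dfn_all (fun e y => B (fun i => e (S i)) y -> e 0 = y)).
apply dfn_imp; [|apply dfn_eq_var].
apply (@dfn_ren1 B (fun i => S (S i)) (fun e => e 0) H), dfnt_var.
Qed.

Lemma dfn_included (s t : (nat -> V) -> V) :
  dfnt s -> dfnt t -> dfn (fun e => included (s e) (t e)).
Proof.
intros Hs Ht; apply (@dfn_all (fun e x => x ∈ s e -> x ∈ t e)), dfn_imp;
  apply dfn_mem; try apply dfnt_var; now apply dfnt_ren.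
Qed.

(** Freezes the surrounding environment: its values become parameters and a single free variable
    remains, which is the form that [separation] accepts. *)
Lemma dfn_inst (A : (nat -> V) -> V -> Prop) e :
  dfn (fun e => A (fun i => e (S i)) (e 0)) -> dfn (fun e' => A e (e' 0)).
Proof.
intros [p [r H]].
exists p, (fun i => match r i with
  | inl O => inl O | inl (S j) => inr (e j) | inr c => inr c end).
intros e'; rewrite <- (H (scons (e' 0) e)).
apply sat_ext; intros i; now destruct (r i) as [[|j]|c].
Qed.

Lemma separation {HZF : ZF V} (P : V -> Prop) (a : V) :
  dfn (fun e => P (e 0)) -> exists b, is_set_of b (fun x => x ∈ a /\ P x).
Proof.
intros [p [r H]].
(* The formula may read other variables of the environment, but its truth depends only on variable
   0. So the constant environment with value [x] may be used, and every environment variable is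
   renamed to the element variable. *)
destruct (zf_separation HZF (ren (fun i => match r i with inl _ => O | _ => S i end) p)
  (fun i => val (fun _ => a) (r i)) a) as [b Hb].
exists b; intros x; rewrite (Hb x), sat_ren, <- (H (fun _ => x)).
enough (E : forall i, scons x (fun i => val (fun _ => a) (r i))
  (match r i with inl _ => O | _ => S i end) = val (fun _ => x) (r i))
  by (now rewrite (sat_ext p E)).
now intros i; destruct (r i) as [j|c] eqn:E; simpl; try rewrite E.
Qed.

End Definability.

Create HintDb dfn discriminated.
#[export] Hint Constants Opaque : dfn.
#[export] Hint Variables Opaque : dfn.
#[export] Hint Resolve dfn_and dfn_or dfn_imp dfn_not dfn_iff dfn_const dfn_all dfn_ex
  dfn_ex_unique dfn_included dfn_mem dfn_eq dfn_elements dfnt_var dfnt_const : dfn.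

(** A hypothesis on a predicate or term variable is stated for one shape of environment only. The
    renaming and the arguments that occur in the goal are read off by patterns and handed to the
    matching renaming lemma. *)
Ltac dfn_hyp :=
  match goal with
  | H : dfnt ?t |- _ => exact H
  | H : dfnt ?t |- _ => is_var t;
      lazymatch goal with |- dfnt (fun e => t (fun i => e (@?g i))) => exact (dfnt_ren g H) end
  | H : dfn (fun e => ?A (fun i => e (S i)) (e 0)) |- _ => is_var A;
      lazymatch goal with
      | |- dfn (fun e => A (fun i => e (@?g i)) (@?s e)) => refine (@dfn_ren1 _ A g s H _)
      | |- dfn (fun e => A e (@?s e)) => refine (@dfn_ren1 _ A (fun i => i) s H _)
      end
  | H : dfn (fun e => ?A (e 1) (e 0)) |- _ => is_var A;
      lazymatch goal with
      | |- dfn (fun e => A (@?s e) (@?t e)) => refine (@dfn_ren2 _ (fun _ => A) S s t H _ _)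
      end
  | H : dfn (fun e => ?A (e 0)) |- _ => is_var A;
      lazymatch goal with
      | |- dfn (fun e => A (@?s e)) => refine (@dfn_ren1 _ (fun _ => A) S s H _)
      end
  | H : dfnt (fun e => ?A (fun i => e (S i)) (e 0)) |- _ => is_var A;
      lazymatch goal with
      | |- dfnt (fun e => A (fun i => e (@?g i)) (@?s e)) => refine (@dfnt_ren1 _ A g s H _)
      | |- dfnt (fun e => A e (@?s e)) => refine (@dfnt_ren1 _ A (fun i => i) s H _)
      end
  | H : dfnt (fun e => ?A (fun i => e (S (S i))) (e 1) (e 0)) |- _ => is_var A;
      lazymatch goal with
      | |- dfnt (fun e => A (fun i => e (@?g i)) (@?s e) (@?t e)) =>
          refine (@dfnt_ren2 _ A g s t H _ _)
      end
  | H : dfnt (fun e => ?A (e 1) (e 0)) |- _ => is_var A;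
      lazymatch goal with
      | |- dfnt (fun e => A (@?s e) (@?t e)) => refine (@dfnt_ren2 _ (fun _ => A) S s t H _ _)
      end
  | H : dfnt (fun e => ?A (e 0)) |- _ => is_var A;
      lazymatch goal with
      | |- dfnt (fun e => A (@?s e)) => refine (@dfnt_ren1 _ (fun _ => A) S s H _)
      end
  end.
#[export] Hint Extern 2 => dfn_hyp : dfn.
Ltac dfn := cbv beta; auto 200 with dfn nocore.

(** * Set operations *)

Section Sets.
Context {V : set_structure} {HZF : ZF V}.
Implicit Types a b c f n m k p s t x y z A B : V.

Lemma set_ext a b : (forall z, z ∈ a <-> z ∈ b) -> a = b.
Proof. apply (zf_extensionality HZF). Qed.

(** By extensionality a first-order description of the elements determines the set, hence describes
    the graph of the term. This is how the sets named by [epsilon] below become usable inside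
    formulas. *)
Lemma dfnt_set (t : (nat -> V) -> V) (Q : (nat -> V) -> V -> Prop) :
  (forall e z, z ∈ t e <-> Q e z) ->
  dfn (fun e => Q (fun i => e (S i)) (e 0)) -> dfnt t.
Proof.
intros H HQ.
apply (@dfn_ext _ (fun e => forall z, z ∈ e 0 <-> Q (fun i => e (S i)) z)); [|dfn].
intros e; split; intros K.
- apply set_ext; intros z; now rewrite (K z), H.
- intros z; now rewrite K, H.
Qed.

(** By extensionality at most one set meets the specification, so nothing is really chosen. If [P]
    is not definable there may be none and the value is arbitrary; hence the [dfn] condition in
    [in_sep]. *)
Definition sep a (P : V -> Prop) : V :=
  epsilon (inhabits a) (fun b => is_set_of b (fun x => x ∈ a /\ P x)).

Lemma in_sep a (P : V -> Prop) x :
  dfn (fun e => P (e 0)) -> (x ∈ sep a P <-> x ∈ a /\ P x).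
Proof. intros H; exact (epsilon_spec (inhabits a) _ (separation a H) x). Qed.

Lemma dfnt_sep (a : (nat -> V) -> V) (P : (nat -> V) -> V -> Prop) :
  dfnt a -> dfn (fun e => P (fun i => e (S i)) (e 0)) ->
  dfnt (fun e => sep (a e) (fun x => P e x)).
Proof.
intros Ha HP; apply (@dfnt_set _ (fun e z => z ∈ a e /\ P e z)); [|dfn].
now intros e z; apply in_sep, dfn_inst.
Qed.

Definition upair x y : V := epsilon (inhabits x) (fun p => is_upair p x y).

Lemma in_upair x y z : z ∈ upair x y <-> z = x \/ z = y.
Proof. exact (epsilon_spec (inhabits x) _ (zf_pairing HZF x y) z). Qed.

Lemma dfnt_upair (s t : (nat -> V) -> V) :
  dfnt s -> dfnt t -> dfnt (fun e => upair (s e) (t e)).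
Proof.
intros Hs Ht; apply (@dfnt_set _ (fun e z => z = s e \/ z = t e)); [|dfn].
intros e z; apply in_upair.
Qed.

Definition bigcup a : V := epsilon (inhabits a) (fun u => is_union u a).

Lemma in_bigcup a z : z ∈ bigcup a <-> exists x, x ∈ a /\ z ∈ x.
Proof. exact (epsilon_spec (inhabits a) _ (zf_union HZF a) z). Qed.

Lemma dfnt_bigcup (s : (nat -> V) -> V) :
  dfnt s -> dfnt (fun e => bigcup (s e)).
Proof.
intros Hs; apply (@dfnt_set _ (fun e z => exists x, x ∈ s e /\ z ∈ x)); [|dfn].
intros e z; apply in_bigcup.
Qed.

Definition pow a : V := epsilon (inhabits a) (fun b => is_set_of b (fun x => included x a)).

Lemma in_pow a z : z ∈ pow a <-> forall x, x ∈ z -> x ∈ a.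
Proof. exact (epsilon_spec (inhabits a) _ (zf_power HZF a) z). Qed.

Lemma dfnt_pow (s : (nat -> V) -> V) :
  dfnt s -> dfnt (fun e => pow (s e)).
Proof.
intros Hs; apply (@dfnt_set _ (fun e z => forall x, x ∈ z -> x ∈ s e)); [|dfn].
intros e z; apply in_pow.
Qed.

#[local] Hint Extern 1 (dfnt (fun e => sep _ _)) => simple apply dfnt_sep : dfn.
#[local] Hint Extern 1 (dfnt (fun e => upair _ _)) => simple apply dfnt_upair : dfn.
#[local] Hint Extern 1 (dfnt (fun e => bigcup _)) => simple apply dfnt_bigcup : dfn.
#[local] Hint Extern 1 (dfnt (fun e => pow _)) => simple apply dfnt_pow : dfn.

Definition cup a b : V := bigcup (upair a b).
Definition opair x y : V := upair (upair x x) (upair x y).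
Definition succ n : V := cup n (upair n n).
Definition prod A B : V :=
  sep (pow (pow (cup A B))) (fun p => exists x y, x ∈ A /\ y ∈ B /\ p = opair x y).
Definition dom f : V := sep (bigcup (bigcup f)) (fun x => exists y, opair x y ∈ f).
(* Read as the union of the values of the relation [f] at [x], so that the
   value is definable also where [f] is not a function. *)
Definition app f x : V :=
  sep (bigcup (bigcup (bigcup f))) (fun z => exists y, opair x y ∈ f /\ z ∈ y).

Lemma dfnt_cup (s t : (nat -> V) -> V) :
  dfnt s -> dfnt t -> dfnt (fun e => cup (s e) (t e)).
Proof. intros; unfold cup; dfn. Qed.
Lemma dfnt_opair (s t : (nat -> V) -> V) :
  dfnt s -> dfnt t -> dfnt (fun e => opair (s e) (t e)).
Proof. intros; unfold opair; dfn. Qed.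
#[local] Hint Extern 1 (dfnt (fun e => cup _ _)) => simple apply dfnt_cup : dfn.
#[local] Hint Extern 1 (dfnt (fun e => opair _ _)) => simple apply dfnt_opair : dfn.
Lemma dfnt_succ (s : (nat -> V) -> V) : dfnt s -> dfnt (fun e => succ (s e)).
Proof. intros; unfold succ; dfn. Qed.
Lemma dfnt_prod (s t : (nat -> V) -> V) :
  dfnt s -> dfnt t -> dfnt (fun e => prod (s e) (t e)).
Proof. intros; unfold prod; dfn. Qed.
Lemma dfnt_dom (s : (nat -> V) -> V) : dfnt s -> dfnt (fun e => dom (s e)).
Proof. intros; unfold dom; dfn. Qed.
Lemma dfnt_app (s t : (nat -> V) -> V) :
  dfnt s -> dfnt t -> dfnt (fun e => app (s e) (t e)).
Proof. intros; unfold app; dfn. Qed.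
#[local] Hint Extern 1 (dfnt (fun e => succ _)) => simple apply dfnt_succ : dfn.
#[local] Hint Extern 1 (dfnt (fun e => prod _ _)) => simple apply dfnt_prod : dfn.
#[local] Hint Extern 1 (dfnt (fun e => dom _)) => simple apply dfnt_dom : dfn.
#[local] Hint Extern 1 (dfnt (fun e => app _ _)) => simple apply dfnt_app : dfn.

Lemma in_cup a b z : z ∈ cup a b <-> z ∈ a \/ z ∈ b.
Proof.
unfold cup; rewrite in_bigcup; split.
- intros [x [H K]]; apply in_upair in H; destruct H; subst; auto.
- intros [H | H]; eexists; rewrite in_upair; eauto.
Qed.

Lemma in_sing x z : z ∈ upair x x <-> z = x.
Proof. rewrite in_upair; tauto. Qed.

Lemma in_succ n z : z ∈ succ n <-> z ∈ n \/ z = n.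
Proof. unfold succ; now rewrite in_cup, in_sing. Qed.

Lemma upair_inj x y y' : upair x y = upair x y' -> y = y'.
Proof.
intros H.
assert (K : y ∈ upair x y') by (rewrite <- H; apply in_upair; auto).
assert (K' : y' ∈ upair x y) by (rewrite H; apply in_upair; auto).
rewrite in_upair in K, K'; destruct K, K'; congruence.
Qed.

Lemma opair_inj x y x' y' : opair x y = opair x' y' <-> x = x' /\ y = y'.
Proof.
split; [|intros [-> ->]; auto]; intros H.
assert (E : x = x').
{ assert (K : upair x x ∈ opair x' y') by (rewrite <- H; apply in_upair; auto).
  apply in_upair in K; destruct K as [K | K].
  - assert (L : x ∈ upair x' x') by (rewrite <- K; apply in_upair; auto).
    now apply in_sing in L.
  - assert (L : x' ∈ upair x x) by (rewrite K; apply in_upair; auto).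
    now apply in_sing in L. }
subst x'; split; auto.
unfold opair in H; eapply upair_inj, upair_inj, H.
Qed.

Lemma is_upairE p x y : is_upair p x y <-> p = upair x y.
Proof.
split; [|intros ->; exact (in_upair x y)].
intros H; apply set_ext; intros z; rewrite (H z), in_upair; tauto.
Qed.

Lemma is_opairE p x y : is_opair p x y <-> p = opair x y.
Proof.
split.
- intros [s [t [Hs [Ht Hp]]]]; rewrite is_upairE in *; subst; reflexivity.
- intros ->; exists (upair x x), (upair x y); rewrite !is_upairE; auto.
Qed.

Lemma mapsE f x y : maps f x y <-> opair x y ∈ f.
Proof.
split.
- intros [p [H K]]; apply is_opairE in H; now subst.
- intros H; exists (opair x y); now rewrite is_opairE.
Qed.

Lemma is_succE s n : is_succ s n <-> s = succ n.
Proof.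
split; [|intros ->; exact (in_succ n)].
intros H; apply set_ext; intros z; rewrite (H z), in_succ; tauto.
Qed.

Lemma in_prod A B p :
  p ∈ prod A B <-> exists x y, x ∈ A /\ y ∈ B /\ p = opair x y.
Proof.
unfold prod; rewrite in_sep by dfn.
split; [tauto|intros H; split; auto].
destruct H as [x [y [Hx [Hy ->]]]].
apply in_pow; intros z Hz; apply in_pow; intros w Hw; apply in_cup.
apply in_upair in Hz; destruct Hz; subst z; apply in_upair in Hw;
  destruct Hw; subst; auto.
Qed.

Lemma opair_in_prod A B x y : opair x y ∈ prod A B <-> x ∈ A /\ y ∈ B.
Proof.
rewrite in_prod; split; [|intros []; eauto].
intros [x' [y' [Hx [Hy E]]]]; apply opair_inj in E; destruct E; now subst.
Qed.

Lemma opair_in_bigcup f x y :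
  opair x y ∈ f -> x ∈ bigcup (bigcup f) /\ y ∈ bigcup (bigcup f).
Proof.
intros H; split; apply in_bigcup; exists (upair x y);
  (split; [|apply in_upair; auto]); apply in_bigcup; exists (opair x y);
  (split; auto); apply in_upair; auto.
Qed.

Lemma in_dom f x : x ∈ dom f <-> exists y, opair x y ∈ f.
Proof.
unfold dom; rewrite in_sep by dfn; split; [tauto|].
intros [y H]; split; [exact (proj1 (opair_in_bigcup H)) | eauto].
Qed.

Lemma app_eq f x y :
  opair x y ∈ f -> (forall y', opair x y' ∈ f -> y' = y) -> app f x = y.
Proof.
intros H K; apply set_ext; intros z; unfold app; rewrite in_sep by dfn; split.
- intros [_ [y' [Hy Hz]]]; now rewrite <- (K y' Hy).
- intros Hz; split; eauto.
  apply in_bigcup; exists y; split; [exact (proj2 (opair_in_bigcup H)) | auto].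
Qed.

Definition funs A B : V :=
  sep (pow (prod A B)) (fun f => forall x, x ∈ A -> exists! y, opair x y ∈ f).

Lemma dfnt_funs (s t : (nat -> V) -> V) :
  dfnt s -> dfnt t -> dfnt (fun e => funs (s e) (t e)).
Proof. intros; unfold funs; dfn. Qed.
#[local] Hint Extern 1 (dfnt (fun e => funs _ _)) => simple apply dfnt_funs : dfn.

Lemma in_funs A B f : f ∈ funs A B <->
  (forall p, p ∈ f -> p ∈ prod A B) /\ forall x, x ∈ A -> exists! y, opair x y ∈ f.
Proof. unfold funs; rewrite in_sep by dfn; now rewrite in_pow. Qed.

(** The statement speaks of functions between classes; from here on functions are members of a set,
    over which Separation and DC can range. *)
Lemma is_funE (P Q : class V) A B f :
  (forall x, P x <-> x ∈ A) -> (forall x, Q x <-> x ∈ B) ->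
  (is_fun f P Q <-> f ∈ funs A B).
Proof.
intros HP HQ; rewrite in_funs; split; intros [H K]; split.
- intros p Hp; destruct (H p Hp) as [x [y [Hx [Hy E]]]]; apply in_prod; exists x, y.
  rewrite <- HP, <- HQ, <- is_opairE; auto.
- intros x Hx; apply HP in Hx; destruct (K x Hx) as [y [Hy U]]; exists y; split.
  + now apply mapsE.
  + intros y' Hy'; now apply U, mapsE.
- intros p Hp; destruct (proj1 (in_prod _ _ _) (H p Hp)) as [x [y [Hx [Hy E]]]].
  exists x, y; rewrite HP, HQ, is_opairE; auto.
- intros x Hx; apply HP in Hx; destruct (K x Hx) as [y [Hy U]]; exists y; split.
  + now apply mapsE.
  + intros y' Hy'; now apply U, mapsE.
Qed.

Lemma funs_maps A B f x y :
  f ∈ funs A B -> (opair x y ∈ f <-> x ∈ A /\ y = app f x).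
Proof.
intros H; apply in_funs in H; destruct H as [H K]; split.
- intros L; specialize (H _ L); apply opair_in_prod in H; destruct H as [Hx Hy].
  split; auto; symmetry; apply app_eq; auto.
  intros y' Hy'; destruct (K x Hx) as [y0 [_ U]].
  now rewrite <- (U y), <- (U y').
- intros [Hx ->]; destruct (K x Hx) as [y0 [H0 U]].
  rewrite (@app_eq f x y0); auto.
  intros y' Hy'; symmetry; auto.
Qed.

Lemma funs_unique A B f x y y' :
  f ∈ funs A B -> opair x y ∈ f -> opair x y' ∈ f -> y = y'.
Proof.
intros H K K'; apply (funs_maps _ _ H) in K, K'; destruct K, K'; congruence.
Qed.

Lemma app_in_graph A B f x : f ∈ funs A B -> x ∈ A -> opair x (app f x) ∈ f.
Proof. intros H Hx; now apply (funs_maps _ _ H). Qed.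

Lemma app_funs A B f x : f ∈ funs A B -> x ∈ A -> app f x ∈ B.
Proof.
intros H Hx; pose proof (app_in_graph H Hx) as K.
apply in_funs in H; destruct H as [H _]; apply H in K.
now apply opair_in_prod in K.
Qed.

Lemma in_fun A B f p :
  f ∈ funs A B -> p ∈ f -> exists x, x ∈ A /\ app f x ∈ B /\ p = opair x (app f x).
Proof.
intros H Hp.
destruct (proj1 (in_prod A B p)) as [x [y [Hx [Hy ->]]]];
  [now apply (proj1 (in_funs _ _ _) H)|].
exists x; apply (funs_maps x y H) in Hp; destruct Hp; subst; auto.
Qed.

Lemma funs_intro A B f :
  (forall p, p ∈ f -> p ∈ prod A B) ->
  (forall x, x ∈ A -> exists y, opair x y ∈ f) ->
  (forall x y y', opair x y ∈ f -> opair x y' ∈ f -> y = y') -> f ∈ funs A B.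
Proof.
intros H K L; apply in_funs; split; auto; intros x Hx.
destruct (K x Hx) as [y Hy]; exists y; split; eauto.
Qed.

Lemma dom_funs A B f : f ∈ funs A B -> dom f = A.
Proof.
intros H; apply set_ext; intros x; rewrite in_dom; split.
- intros [y Hy]; now apply (funs_maps x y H) in Hy.
- intros Hx; exists (app f x); now apply (app_in_graph H).
Qed.

Lemma funs_sub A A' B B' f g :
  f ∈ funs A B -> g ∈ funs A' B' ->
  (forall x, x ∈ A -> x ∈ A' /\ app f x = app g x) -> included f g.
Proof.
intros Hf Hg H p Hp; destruct (in_fun Hf Hp) as [x [Hx [_ ->]]].
destruct (H x Hx) as [H1 H2]; now rewrite H2; apply (app_in_graph Hg).
Qed.

Lemma funs_ext A B B' f g :
  f ∈ funs A B -> g ∈ funs A B' ->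
  (forall x, x ∈ A -> app f x = app g x) -> f = g.
Proof.
intros Hf Hg H; apply set_ext; intros z; split.
- apply (funs_sub Hf Hg); auto.
- apply (funs_sub Hg Hf); intros x Hx; rewrite H; auto.
Qed.

Lemma app_sub A A' B B' f g x :
  f ∈ funs A B -> g ∈ funs A' B' -> included f g -> x ∈ A ->
  x ∈ A' /\ app f x = app g x.
Proof.
intros Hf Hg H Hx; apply (funs_maps _ _ Hg), H, (app_in_graph Hf Hx).
Qed.

Lemma funs_widen A B B' f :
  f ∈ funs A B -> (forall x, x ∈ A -> app f x ∈ B') -> f ∈ funs A B'.
Proof.
intros H K; apply in_funs; split; [|now apply in_funs in H].
intros p Hp; destruct (in_fun H Hp) as [x [Hx [_ ->]]].
apply opair_in_prod; auto.
Qed.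

Definition lam A B (F : V -> V) : V :=
  sep (prod A B) (fun p => exists x, x ∈ A /\ p = opair x (F x)).

Lemma dfnt_lam (s t : (nat -> V) -> V) (F : (nat -> V) -> V -> V) :
  dfnt s -> dfnt t -> dfnt (fun e => F (fun i => e (S i)) (e 0)) ->
  dfnt (fun e => lam (s e) (t e) (fun x => F e x)).
Proof. intros; unfold lam; dfn. Qed.

Lemma lam_funs A B F : dfnt (fun e => F (e 0)) ->
  (forall x, x ∈ A -> F x ∈ B) -> lam A B F ∈ funs A B.
Proof.
intros HF H.
assert (E : forall x y, opair x y ∈ lam A B F <-> x ∈ A /\ y = F x).
{ intros x y; unfold lam; rewrite in_sep by dfn; rewrite opair_in_prod; split.
  - intros [_ [x' [Hx E]]]; apply opair_inj in E; destruct E; now subst.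
  - intros [Hx ->]; split; [auto | now exists x]. }
apply funs_intro.
- intros p; unfold lam; rewrite in_sep by dfn; tauto.
- intros x Hx; exists (F x); now rewrite E.
- intros x y y' K K'; rewrite E in K, K'; destruct K, K'; congruence.
Qed.

Lemma app_lam A B F x : dfnt (fun e => F (e 0)) ->
  (forall x, x ∈ A -> F x ∈ B) -> x ∈ A -> app (lam A B F) x = F x.
Proof.
intros HF H Hx; symmetry; apply (funs_maps _ _ (lam_funs HF H)).
unfold lam; rewrite in_sep by dfn; rewrite opair_in_prod.
split; [auto | now exists x].
Qed.

Lemma is_comp_lam A B D f g : f ∈ funs A B -> g ∈ funs B D ->
  is_comp (lam A D (fun x => app g (app f x))) g f.
Proof.
intros Hf Hg p.
assert (HF : dfnt (fun e => app g (app f (e 0)))) by dfn.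
assert (HD : forall x, x ∈ A -> app g (app f x) ∈ D)
  by (intros x Hx; exact (app_funs Hg (app_funs Hf Hx))).
assert (HL := lam_funs HF HD); split.
- intros Hp; destruct (in_fun HL Hp) as [x [Hx [_ ->]]].
  exists x, (app f x), (app g (app f x)); rewrite !mapsE, is_opairE.
  rewrite (app_lam HF HD Hx); repeat split; [exact (app_in_graph Hf Hx)|].
  exact (app_in_graph Hg (app_funs Hf Hx)).
- intros [x [y [z [H [K E]]]]]; apply is_opairE in E; subst p.
  rewrite mapsE in H, K; apply (funs_maps _ _ Hf) in H; destruct H as [Hx ->].
  apply (funs_maps _ _ Hg) in K; destruct K as [_ ->].
  apply (funs_maps _ _ HL); now rewrite (app_lam HF HD Hx).
Qed.

End Sets.

#[export] Hint Extern 1 (dfnt (fun e => sep _ _)) => simple apply dfnt_sep : dfn.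
#[export] Hint Extern 1 (dfnt (fun e => upair _ _)) => simple apply dfnt_upair : dfn.
#[export] Hint Extern 1 (dfnt (fun e => bigcup _)) => simple apply dfnt_bigcup : dfn.
#[export] Hint Extern 1 (dfnt (fun e => pow _)) => simple apply dfnt_pow : dfn.
#[export] Hint Extern 1 (dfnt (fun e => cup _ _)) => simple apply dfnt_cup : dfn.
#[export] Hint Extern 1 (dfnt (fun e => opair _ _)) => simple apply dfnt_opair : dfn.
#[export] Hint Extern 1 (dfnt (fun e => succ _)) => simple apply dfnt_succ : dfn.
#[export] Hint Extern 1 (dfnt (fun e => prod _ _)) => simple apply dfnt_prod : dfn.
#[export] Hint Extern 1 (dfnt (fun e => dom _)) => simple apply dfnt_dom : dfn.
#[export] Hint Extern 1 (dfnt (fun e => app _ _)) => simple apply dfnt_app : dfn.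
#[export] Hint Extern 1 (dfnt (fun e => funs _ _)) => simple apply dfnt_funs : dfn.
#[export] Hint Extern 1 (dfnt (fun e => lam _ _ _)) => simple apply dfnt_lam : dfn.

(** * Natural numbers and recursion *)

Section Naturals.
Context {V : set_structure} {HZF : ZF V}.
Implicit Types a b c f n m k p s t x y z A B : V.

Lemma dfn_is_inductive (t : (nat -> V) -> V) :
  dfnt t -> dfn (fun e => is_inductive (t e)).
Proof.
intros; apply (@dfn_ext _ (fun e =>
  (exists z, (forall y, y ∈ z <-> False) /\ z ∈ t e) /\
  (forall n, n ∈ t e -> exists s, s = succ n /\ s ∈ t e))); [|dfn].
intros e; apply and_iff_compat_l.
split; intros K n Hn; destruct (K n Hn) as [s Hs]; exists s;
  now rewrite is_succE in *.
Qed.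
#[local] Hint Extern 1 (dfn (fun e => is_inductive _)) => simple apply dfn_is_inductive : dfn.

(** Some inductive set, which serves as a parameter. [om] does not depend on the one taken, as it
    keeps only what all inductive sets share. *)
Definition infinite_set : V :=
  proj1_sig (constructive_indefinite_description _ (zf_infinity HZF)).

Definition om : V := sep infinite_set (fun n => forall I, is_inductive I -> n ∈ I).

Lemma omegaE n : omega n <-> n ∈ om.
Proof.
unfold om; rewrite in_sep by dfn; split; [|intros [_ H]; exact H].
intros H; split; [|exact H]; apply H; unfold infinite_set.
now destruct (constructive_indefinite_description _ _).
Qed.

Definition zero : V := sep om (fun _ => False).

Lemma in_zero z : ~ z ∈ zero.
Proof. unfold zero; rewrite in_sep by dfn; tauto. Qed.

Lemma is_emptyE z : is_empty z <-> z = zero.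
Proof.
split.
- intros H; apply set_ext; intros x; rewrite (H x); split; [tauto | apply in_zero].
- intros -> x; split; [apply in_zero | tauto].
Qed.

Lemma zero_om : zero ∈ om.
Proof.
apply (proj1 (omegaE _)); intros I [[z [Hz HI]] _]; apply is_emptyE in Hz; now subst.
Qed.

Lemma succ_om n : n ∈ om -> succ n ∈ om.
Proof.
rewrite <- !omegaE; intros H I HI; destruct (HI) as [_ K].
destruct (K n (H I HI)) as [s [Hs Is]]; apply is_succE in Hs; now subst.
Qed.

(** The natural numbers of [V] may be nonstandard, so induction has to go through an inductive set
    of [V] and is available for definable predicates only. *)
Lemma om_ind (P : V -> Prop) : dfn (fun e => P (e 0)) ->
  P zero -> (forall n, n ∈ om -> P n -> P (succ n)) -> forall n, n ∈ om -> P n.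
Proof.
intros HP H0 HS n Hn.
enough (K : n ∈ sep om P) by now apply in_sep in K.
apply omegaE in Hn; apply Hn; split.
- exists zero; rewrite is_emptyE, in_sep by auto; auto using zero_om.
- intros m; rewrite in_sep by auto; intros [Hm Pm]; exists (succ m).
  rewrite is_succE, in_sep by auto; auto using succ_om.
Qed.

End Naturals.

Arguments om {V HZF}.
Arguments zero {V HZF}.
#[export] Hint Extern 1 (dfn (fun e => is_inductive _)) => simple apply dfn_is_inductive : dfn.

Ltac om_induction :=
  match goal with |- forall n, n ∈ om -> @?P n =>
    refine (@om_ind _ _ P _ _ _); [solve [dfn] | |]; cbv beta
  end.

Section Arithmetic.
Context {V : set_structure} {HZF : ZF V}.
Implicit Types a b c f n m k p s t x y z A B : V.

Lemma om_case : forall n, n ∈ om -> n = zero \/ exists m, m ∈ om /\ n = succ m.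
Proof. om_induction; eauto. Qed.

Lemma mem_succ n : n ∈ succ n.
Proof. apply in_succ; auto. Qed.

Lemma mem_succ_of_mem m n : m ∈ n -> m ∈ succ n.
Proof. intros; apply in_succ; auto. Qed.

Lemma om_trans : forall n, n ∈ om -> forall m, m ∈ n -> m ∈ om.
Proof.
om_induction.
- intros m H; now apply in_zero in H.
- intros k Hk IH m Hm; apply in_succ in Hm; destruct Hm; subst; auto.
Qed.

Lemma mem_trans : forall n, n ∈ om -> forall m k, m ∈ n -> k ∈ m -> k ∈ n.
Proof.
om_induction.
- intros m k H; now apply in_zero in H.
- intros l Hl IH m k Hm Hk; rewrite in_succ in *; destruct Hm; subst; eauto.
Qed.

Lemma mem_irrefl n : ~ n ∈ n.
Proof.
intros H; destruct (zf_foundation HZF (a := upair n n)) as [z [Hz K]].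
- exists n; now apply in_sing.
- apply in_sing in Hz; subst; apply K; exists n; now rewrite in_sing.
Qed.

Lemma zero_mem_succ : forall n, n ∈ om -> zero ∈ succ n.
Proof.
om_induction; [apply mem_succ |].
intros; now apply mem_succ_of_mem.
Qed.

Lemma succ_mem_succ : forall n, n ∈ om -> forall m, m ∈ n -> succ m ∈ succ n.
Proof.
om_induction.
- intros m H; now apply in_zero in H.
- intros k Hk IH m Hm; apply in_succ in Hm; destruct Hm; subst; rewrite in_succ; auto.
Qed.

Lemma mem_total : forall n, n ∈ om -> forall m, m ∈ om -> m ∈ n \/ m = n \/ n ∈ m.
Proof.
om_induction.
- intros m Hm; destruct (om_case Hm) as [-> | [k [Hk ->]]]; auto using zero_mem_succ.
- intros k Hk IH m Hm; rewrite in_succ.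
  destruct (IH m Hm) as [H | [-> | H]]; auto.
  apply (succ_mem_succ Hm) in H; apply in_succ in H; destruct H; auto.
Qed.

Lemma mem_asym n m : n ∈ om -> m ∈ n -> ~ n ∈ m.
Proof. intros Hn H K; exact (mem_irrefl (mem_trans Hn H K)). Qed.

Lemma succ_inj n m : n ∈ om -> m ∈ om -> succ n = succ m -> n = m.
Proof.
intros Hn Hm H.
assert (K : n ∈ succ m) by (rewrite <- H; apply mem_succ).
assert (L : m ∈ succ n) by (rewrite H; apply mem_succ).
rewrite in_succ in K, L; destruct K as [K|K], L as [L|L]; auto.
now destruct (mem_asym Hn L).
Qed.

Lemma succ_neq_zero n : succ n <> zero.
Proof. intros H; apply (@in_zero _ _ n); rewrite <- H; apply mem_succ. Qed.

(** Foundation yields an [∈]-minimal element, and minimal means least because [∈] is total on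
    [om]. *)
Lemma om_least (P : V -> Prop) : dfn (fun e => P (e 0)) ->
  (exists n, n ∈ om /\ P n) ->
  exists n, n ∈ om /\ P n /\ forall m, m ∈ om -> P m -> n = m \/ n ∈ m.
Proof.
intros HP [n [Hn Pn]].
destruct (zf_foundation HZF (a := sep om P)) as [m [Hm K]].
- exists n; now rewrite in_sep.
- rewrite in_sep in Hm by auto; destruct Hm as [Hm Pm].
  exists m; repeat split; auto; intros k Hk Pk.
  destruct (mem_total Hk Hm) as [L | [L | L]]; auto.
  exfalso; apply K; exists k; now rewrite in_sep.
Qed.

(* The union of the least elements of [P], of which there is at most one. *)
Definition least (P : V -> Prop) : V :=
  bigcup (sep om (fun n => P n /\ forall m, m ∈ om -> P m -> n = m \/ n ∈ m)).

Lemma dfnt_least (P : (nat -> V) -> V -> Prop) :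
  dfn (fun e => P (fun i => e (S i)) (e 0)) -> dfnt (fun e => least (fun x => P e x)).
Proof. intros; unfold least; dfn. Qed.

Lemma least_spec (P : V -> Prop) : dfn (fun e => P (e 0)) ->
  (exists n, n ∈ om /\ P n) -> least P ∈ om /\ P (least P).
Proof.
intros HP H; destruct (om_least HP H) as [n [Hn [Pn K]]].
enough (E : least P = n) by (rewrite E; auto).
apply set_ext; intros z; unfold least; rewrite in_bigcup; split.
- intros [m [Hm Hz]]; rewrite in_sep in Hm by dfn; destruct Hm as [Hm [Pm L]].
  enough (m = n) by (now subst).
  destruct (K m Hm Pm) as [?|M]; auto; destruct (L n Hn Pn) as [?|N]; auto.
  now destruct (mem_asym Hn N).
- intros Hz; exists n; rewrite in_sep by dfn; auto.
Qed.

(** The graph is the smallest relation that contains the initial pair and is closed under the step,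
    given as what all closed sets have in common. In this form its definability is immediate and no
    finite approximations are needed. *)
Definition rec A a (G : V -> V -> V) : V :=
  sep (prod om A) (fun p => forall R, opair zero a ∈ R ->
    (forall n x, n ∈ om -> opair n x ∈ R -> opair (succ n) (G n x) ∈ R) -> p ∈ R).

Lemma dfnt_rec (s t : (nat -> V) -> V) (G : (nat -> V) -> V -> V -> V) :
  dfnt s -> dfnt t -> dfnt (fun e => G (fun i => e (S (S i))) (e 1) (e 0)) ->
  dfnt (fun e => rec (s e) (t e) (fun n x => G e n x)).
Proof. intros; unfold rec; dfn. Qed.

Section Recursion.
Variables (A a : V) (G : V -> V -> V).
Hypothesis (HG : dfnt (fun e => G (e 1) (e 0))).
Hypothesis (Aa : a ∈ A) (AG : forall n x, n ∈ om -> x ∈ A -> G n x ∈ A).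

Lemma in_rec p : p ∈ rec A a G <-> p ∈ prod om A /\ forall R, opair zero a ∈ R ->
    (forall n x, n ∈ om -> opair n x ∈ R -> opair (succ n) (G n x) ∈ R) -> p ∈ R.
Proof. unfold rec; rewrite in_sep by dfn; reflexivity. Qed.

Lemma rec_graph_zero : opair zero a ∈ rec A a G.
Proof. rewrite in_rec, opair_in_prod; auto using zero_om. Qed.

Lemma rec_graph_succ n x :
  n ∈ om -> opair n x ∈ rec A a G -> opair (succ n) (G n x) ∈ rec A a G.
Proof.
rewrite !in_rec, !opair_in_prod; intros Hn [[_ Hx] H].
split; [auto using succ_om | intros R R0 RS; apply RS; auto].
Qed.

Lemma rec_graph_ind (Q : V -> Prop) : dfn (fun e => Q (e 0)) -> Q (opair zero a) ->
  (forall n x, n ∈ om -> opair n x ∈ rec A a G -> Q (opair n x) ->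
    Q (opair (succ n) (G n x))) ->
  forall p, p ∈ rec A a G -> Q p.
Proof.
intros HQ H0 HS p Hp; apply in_rec in Hp.
enough (K : p ∈ sep (rec A a G) Q) by now apply in_sep in K.
apply Hp; [apply in_sep; auto using rec_graph_zero|].
intros n x Hn; rewrite !in_sep by auto; intros []; auto using rec_graph_succ.
Qed.

Lemma rec_graph_zero_inv x : opair zero x ∈ rec A a G -> x = a.
Proof.
intros H; assert (K := @rec_graph_ind (fun p => p = opair zero x -> x = a)).
apply K in H; auto; [dfn | |].
- intros E; apply opair_inj in E; now destruct E.
- intros n y _ _ _ E; apply opair_inj in E; destruct E as [E _].
  now apply succ_neq_zero in E.
Qed.

(** Minimality of the graph: a pair whose first entry is a successor can only have entered through
    the step. *)
Lemma rec_graph_succ_inv n x : n ∈ om -> opair (succ n) x ∈ rec A a G ->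
  exists y, opair n y ∈ rec A a G /\ x = G n y.
Proof.
intros Hn H; assert (K := @rec_graph_ind (fun p => p = opair (succ n) x ->
  exists y, opair n y ∈ rec A a G /\ x = G n y)).
apply K in H; auto; [dfn | |].
- intros E; apply opair_inj in E; destruct E as [E _].
  symmetry in E; now apply succ_neq_zero in E.
- intros m y Hm Hy _ E; apply opair_inj in E; destruct E as [E <-].
  apply succ_inj in E; auto; subst m; eauto.
Qed.

Lemma rec_funs : rec A a G ∈ funs om A.
Proof.
apply funs_intro.
- intros p Hp; now apply in_rec in Hp.
- om_induction; [exists a; apply rec_graph_zero |].
  intros n Hn [y Hy]; eexists; now apply rec_graph_succ, Hy.
- enough (H : forall x, x ∈ om -> forall y y',
    opair x y ∈ rec A a G -> opair x y' ∈ rec A a G -> y = y').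
  { intros x y y' Hy; apply H with (y := y); auto; apply in_rec in Hy.
    destruct Hy as [Hy _]; now apply opair_in_prod in Hy. }
  om_induction.
  + intros y y' Hy Hy'; apply rec_graph_zero_inv in Hy, Hy'; congruence.
  + intros n Hn IH y y' Hy Hy'; apply rec_graph_succ_inv in Hy, Hy'; auto.
    destruct Hy as [z [Hz ->]], Hy' as [z' [Hz' ->]].
    now rewrite (IH z z').
Qed.

Lemma rec_zero : app (rec A a G) zero = a.
Proof. symmetry; apply (funs_maps _ _ rec_funs), rec_graph_zero. Qed.

Lemma rec_succ n : n ∈ om -> app (rec A a G) (succ n) = G n (app (rec A a G) n).
Proof.
intros Hn; symmetry; apply (funs_maps _ _ rec_funs), rec_graph_succ; auto.
now apply (app_in_graph rec_funs).
Qed.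

End Recursion.

(** * Finite and infinite sequences *)

Definition fs B : V := sep (pow (prod om B)) (fun t => exists k, k ∈ om /\ t ∈ funs k B).

Lemma dfnt_fs (s : (nat -> V) -> V) : dfnt s -> dfnt (fun e => fs (s e)).
Proof. intros; unfold fs; dfn. Qed.

Lemma in_fs B t : t ∈ fs B <-> dom t ∈ om /\ t ∈ funs (dom t) B.
Proof.
unfold fs; rewrite in_sep by dfn; split.
- intros [_ [k [Hk H]]]; now rewrite (dom_funs H).
- intros [H K]; split; eauto; apply in_pow; intros p Hp.
  destruct (in_fun K Hp) as [x [Hx [Hy ->]]]; apply opair_in_prod.
  split; auto; now apply (om_trans H).
Qed.

Lemma fs_funs k B t : k ∈ om -> t ∈ funs k B -> t ∈ fs B.
Proof. intros Hk H; apply in_fs; now rewrite (dom_funs H). Qed.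

Lemma finseqE t : finseq t <-> t ∈ fs om.
Proof.
rewrite in_fs; split.
- intros [k [Hk H]]; rewrite (is_funE (A := k) (B := om)) in H;
    [|reflexivity|apply omegaE].
  rewrite omegaE in Hk; now rewrite (dom_funs H).
- intros [Hk H]; exists (dom t); split; [now apply omegaE|].
  rewrite (is_funE (A := dom t) (B := om)); [auto|reflexivity|apply omegaE].
Qed.

Lemma finseq_of_lengthE t k : finseq_of_length t k <-> t ∈ fs om /\ dom t = k.
Proof.
unfold finseq_of_length; rewrite (is_funE (A := k) (B := om)), omegaE;
  [|reflexivity|apply omegaE].
rewrite in_fs; split.
- intros [Hk H]; now rewrite (dom_funs H).
- intros [[]]; now subst.
Qed.

Lemma baireE b : baire b <-> b ∈ funs om om.
Proof. apply is_funE; apply omegaE. Qed.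

Lemma zero_fs B : zero ∈ fs B.
Proof.
apply (@fs_funs zero); [apply zero_om|apply funs_intro].
- intros p Hp; now apply in_zero in Hp.
- intros x Hx; now apply in_zero in Hx.
- intros x y y' H; now apply in_zero in H.
Qed.

Lemma dom_zero : dom zero = zero.
Proof.
apply set_ext; intros x; rewrite in_dom; split.
- intros [y H]; now apply in_zero in H.
- intros H; now apply in_zero in H.
Qed.

Definition snoc t v : V := cup t (upair (opair (dom t) v) (opair (dom t) v)).

Lemma dfnt_snoc (s t : (nat -> V) -> V) :
  dfnt s -> dfnt t -> dfnt (fun e => snoc (s e) (t e)).
Proof. intros; unfold snoc; dfn. Qed.

Lemma in_snoc t v p : p ∈ snoc t v <-> p ∈ t \/ p = opair (dom t) v.
Proof. unfold snoc; now rewrite in_cup, in_sing. Qed.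

Lemma is_snoc_snoc t n : t ∈ fs om -> is_snoc (snoc t n) t n.
Proof.
intros Ht; exists (dom t), (opair (dom t) n).
rewrite finseq_of_lengthE, is_opairE; repeat split; auto.
- intros H; now apply in_snoc.
- intros H; now apply in_snoc.
Qed.

Lemma sub_snoc t v : included t (snoc t v).
Proof. intros p Hp; apply in_snoc; auto. Qed.

Lemma dom_snoc t v : dom (snoc t v) = succ (dom t).
Proof.
apply set_ext; intros x; rewrite in_dom, in_succ; split.
- intros [y H]; apply in_snoc in H; destruct H as [H | H].
  + left; apply in_dom; eauto.
  + apply opair_inj in H; destruct H; auto.
- intros [H | ->].
  + apply in_dom in H; destruct H as [y H]; exists y; apply in_snoc; auto.
  + exists v; apply in_snoc; auto.
Qed.

Lemma snoc_fs B t v : t ∈ fs B -> v ∈ B -> snoc t v ∈ fs B.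
Proof.
rewrite !in_fs, dom_snoc; intros [Hd Ht] Hv; split; [now apply succ_om|].
apply funs_intro.
- intros p Hp; apply in_snoc in Hp; destruct Hp as [Hp | ->].
  + destruct (in_fun Ht Hp) as [x [Hx [Hy ->]]].
    apply opair_in_prod; split; auto; now apply mem_succ_of_mem.
  + apply opair_in_prod; split; auto using mem_succ.
- intros x Hx; rewrite <- (dom_snoc t v) in Hx; now apply in_dom.
- intros x y y'; rewrite !in_snoc; intros [H | H] [H' | H'].
  + exact (funs_unique Ht H H').
  + apply (funs_maps x _ Ht) in H; apply opair_inj in H'; destruct H as [H _], H' as [-> _].
    now apply mem_irrefl in H.
  + apply (funs_maps x _ Ht) in H'; apply opair_inj in H; destruct H' as [H' _], H as [-> _].
    now apply mem_irrefl in H'.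
  + apply opair_inj in H, H'; destruct H, H'; congruence.
Qed.

Lemma app_snoc_last B t v : t ∈ fs B -> v ∈ B -> app (snoc t v) (dom t) = v.
Proof.
intros Ht Hv; assert (K := proj2 (proj1 (in_fs _ _) (snoc_fs Ht Hv))).
symmetry; apply (funs_maps _ _ K), in_snoc; auto.
Qed.

Lemma app_sub_fs B t b n : t ∈ fs B -> b ∈ fs B \/ b ∈ funs om B ->
  included t b -> n ∈ dom t -> app t n = app b n.
Proof.
intros Ht Hb H Hn; apply in_fs in Ht; destruct Ht as [_ Ht].
destruct Hb as [Hb | Hb]; [apply in_fs in Hb; destruct Hb as [_ Hb]|];
  now apply (app_sub Ht Hb H).
Qed.

Lemma app_snoc_init B t v n :
  t ∈ fs B -> v ∈ B -> n ∈ dom t -> app (snoc t v) n = app t n.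
Proof.
intros Ht Hv Hn; symmetry; apply (@app_sub_fs B); auto using snoc_fs, sub_snoc.
Qed.

Lemma dom_sub s t : included s t -> included (dom s) (dom t).
Proof. intros H x Hx; apply in_dom in Hx; destruct Hx as [y Hy]; apply in_dom; exists y; now apply H. Qed.

Lemma included_refl a : included a a.
Proof. intros x Hx; exact Hx. Qed.

Lemma included_trans a b c : included a b -> included b c -> included a c.
Proof. intros H K x Hx; now apply K, H. Qed.

Lemma sub_om m n : m ∈ om -> n ∈ om -> included m n -> m = n \/ m ∈ n.
Proof.
intros Hm Hn H; destruct (mem_total Hn Hm) as [K | [K | K]]; auto.
apply H in K; now apply mem_irrefl in K.
Qed.

Lemma mem_sub m n : n ∈ om -> m ∈ n -> included m n.
Proof. intros Hn H k Hk; exact (mem_trans Hn H Hk). Qed.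

Definition res b n : V := sep b (fun p => exists x y, x ∈ n /\ p = opair x y).

Lemma dfnt_res (s t : (nat -> V) -> V) :
  dfnt s -> dfnt t -> dfnt (fun e => res (s e) (t e)).
Proof. intros; unfold res; dfn. Qed.

Lemma in_res b n p : p ∈ res b n <-> p ∈ b /\ exists x y, x ∈ n /\ p = opair x y.
Proof. unfold res; now rewrite in_sep by dfn. Qed.

Lemma res_sub b n : included (res b n) b.
Proof. intros p Hp; now apply in_res in Hp. Qed.

Lemma res_funs A B b n : b ∈ funs A B -> included n A -> res b n ∈ funs n B.
Proof.
intros Hb Hn; apply funs_intro.
- intros p Hp; apply in_res in Hp; destruct Hp as [Hp [x [y [Hx ->]]]].
  apply (funs_maps _ _ Hb) in Hp; destruct Hp as [Hp ->].
  apply opair_in_prod; split; auto; now apply (app_funs Hb).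
- intros x Hx; exists (app b x); apply in_res; split; [|eauto].
  now apply (app_in_graph Hb), Hn.
- intros x y y'; rewrite !in_res; intros [H _] [H' _].
  exact (funs_unique Hb H H').
Qed.

Lemma om_sub n : n ∈ om -> included n om.
Proof. intros Hn; exact (om_trans Hn). Qed.

Lemma res_fs B b n : b ∈ funs om B -> n ∈ om -> res b n ∈ fs B.
Proof. intros Hb Hn; apply (fs_funs Hn), (res_funs Hb), om_sub, Hn. Qed.

Lemma dom_res B b n : b ∈ funs om B -> n ∈ om -> dom (res b n) = n.
Proof. intros Hb Hn; apply (dom_funs (res_funs Hb (om_sub Hn))). Qed.

Lemma res_eq B t b : t ∈ fs B -> b ∈ funs om B -> included t b -> t = res b (dom t).
Proof.
intros Ht Hb H; apply in_fs in Ht; destruct Ht as [Hd Ht].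
apply (funs_ext Ht (res_funs Hb (om_sub Hd))).
intros x Hx; rewrite (proj2 (app_sub Ht Hb H Hx)).
symmetry; apply (app_sub (res_funs Hb (om_sub Hd)) Hb (@res_sub _ _) Hx).
Qed.

Lemma res_mono B b m n : b ∈ funs om B -> included m n ->
  included (res b m) (res b n).
Proof.
intros Hb H p Hp; apply in_res in Hp; destruct Hp as [Hp [x [y [Hx ->]]]].
apply in_res; split; [exact Hp|]; exists x, y; split; [now apply H | reflexivity].
Qed.

Lemma sub_comparable B s t b : s ∈ fs B -> t ∈ fs B -> b ∈ funs om B ->
  included s b -> included t b -> included (dom s) (dom t) -> included s t.
Proof.
intros Hs Ht Hb Hsb Htb H.
rewrite (res_eq Hs Hb Hsb), (res_eq Ht Hb Htb); now apply (res_mono Hb).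
Qed.

Lemma fs_ext B s t : s ∈ fs B -> t ∈ fs B -> dom s = dom t ->
  (forall n, n ∈ dom s -> app s n = app t n) -> s = t.
Proof.
rewrite !in_fs; intros [_ Hs] [_ Ht] E; rewrite E in *; apply (funs_ext Hs Ht).
Qed.

Lemma snoc_eq B t n : t ∈ fs B -> n ∈ om -> dom t = succ n ->
  t = snoc (res t n) (app t n) /\ res t n ∈ fs B /\ app t n ∈ B /\ dom (res t n) = n.
Proof.
intros Ht Hn E; destruct (proj1 (in_fs _ _) Ht) as [_ Hf].
assert (Hr : res t n ∈ funs n B).
{ apply (res_funs Hf); rewrite E; intros x; apply mem_succ_of_mem. }
assert (Hv : app t n ∈ B) by (apply (app_funs Hf); rewrite E; apply mem_succ).
assert (Hd := dom_funs Hr); apply (fs_funs Hn) in Hr.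
repeat split; auto.
apply (@fs_ext B); auto using snoc_fs.
- now rewrite dom_snoc, Hd.
- rewrite E; intros m Hm; apply in_succ in Hm; destruct Hm as [Hm | ->].
  + rewrite (app_snoc_init Hr Hv) by now rewrite Hd.
    symmetry; apply (@app_sub_fs B); auto using res_sub; now rewrite Hd.
  + assert (L := app_snoc_last Hr Hv); rewrite Hd in L; now rewrite L.
Qed.

Lemma fs_ind B (P : V -> Prop) : dfn (fun e => P (e 0)) -> P zero ->
  (forall t v, t ∈ fs B -> v ∈ B -> P t -> P (snoc t v)) -> forall t, t ∈ fs B -> P t.
Proof.
intros HP H0 HS.
enough (K : forall n, n ∈ om -> forall t, t ∈ fs B -> dom t = n -> P t).
{ intros t Ht; apply (K (dom t)); auto; now apply in_fs in Ht. }
om_induction.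
- intros t Ht E; replace t with zero; auto.
  apply (@fs_ext B); auto using zero_fs; rewrite dom_zero; auto.
  intros n Hn; now apply in_zero in Hn.
- intros n Hn IH t Ht E; destruct (snoc_eq Ht Hn E) as [E' [H1 [H2 H3]]].
  rewrite E'; auto.
Qed.

Definition lim B F : V := sep (prod om B) (fun p => exists k, k ∈ om /\ p ∈ app F k).

Lemma dfnt_lim (s t : (nat -> V) -> V) :
  dfnt s -> dfnt t -> dfnt (fun e => lim (s e) (t e)).
Proof. intros; unfold lim; dfn. Qed.

Section Limits.
Variables B F : V.
Hypothesis HF : F ∈ funs om (fs B).
Hypothesis HS : forall k, k ∈ om -> included (app F k) (app F (succ k)) /\
  dom (app F k) ∈ dom (app F (succ k)).

Lemma chain_mono : forall m, m ∈ om -> forall k, k ∈ succ m ->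
  included (app F k) (app F m).
Proof.
om_induction.
- intros k Hk; apply in_succ in Hk; destruct Hk as [Hk | ->].
  + now apply in_zero in Hk.
  + apply included_refl.
- intros n Hn IH k Hk; apply in_succ in Hk; destruct Hk as [Hk | ->].
  + exact (included_trans (IH k Hk) (proj1 (HS Hn))).
  + apply included_refl.
Qed.

Lemma chain_fs k : k ∈ om -> app F k ∈ fs B.
Proof. exact (app_funs HF). Qed.

Lemma chain_dom_om k : k ∈ om -> dom (app F k) ∈ om.
Proof. intros Hk; now apply chain_fs, in_fs in Hk. Qed.

(** Lengths are natural numbers that increase strictly along the chain. This bound is what makes the
    union of the chain total. *)
Lemma chain_dom : forall k, k ∈ om -> k ∈ succ (dom (app F k)).
Proof.
om_induction.
- apply zero_mem_succ, chain_dom_om, zero_om.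
- intros n Hn IH; destruct (HS Hn) as [_ H].
  apply succ_mem_succ; [now apply chain_dom_om, succ_om|].
  apply in_succ in IH; destruct IH as [IH | IH].
  + exact (mem_trans (chain_dom_om (succ_om Hn)) H IH).
  + now rewrite <- IH in H.
Qed.

Lemma chain_lt k m : k ∈ om -> m ∈ om -> k ∈ m -> k ∈ dom (app F m).
Proof.
intros Hk Hm H; assert (K := chain_dom Hm); apply in_succ in K.
destruct K as [K | <-]; auto.
exact (mem_trans (chain_dom_om Hm) K H).
Qed.

Lemma in_lim p : p ∈ lim B F <-> exists k, k ∈ om /\ p ∈ app F k.
Proof.
unfold lim; rewrite in_sep by dfn; split; [tauto|intros [k [Hk H]]; split; eauto].
assert (K := chain_fs Hk); apply in_fs in K; destruct K as [K L].
destruct (in_fun L H) as [x [Hx [Hy ->]]]; apply opair_in_prod; split; auto.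
now apply (om_trans K).
Qed.

Lemma chain_total k m : k ∈ om -> m ∈ om ->
  included (app F k) (app F m) \/ included (app F m) (app F k).
Proof.
intros Hk Hm; destruct (mem_total Hk Hm) as [H | [-> | H]].
- right; apply chain_mono; auto; now apply mem_succ_of_mem.
- left; apply included_refl.
- left; apply chain_mono; auto; now apply mem_succ_of_mem.
Qed.

Lemma lim_funs : lim B F ∈ funs om B.
Proof.
apply funs_intro.
- intros p; unfold lim; rewrite in_sep by dfn; tauto.
- intros x Hx; assert (K := chain_lt Hx (succ_om Hx) (mem_succ x)).
  apply in_dom in K; destruct K as [y Hy]; exists y; apply in_lim; eauto using succ_om.
- intros x y y'; rewrite !in_lim; intros [k [Hk H]] [m [Hm H']].
  enough (E : exists n, n ∈ om /\ opair x y ∈ app F n /\ opair x y' ∈ app F n).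
  { destruct E as [n [Hn [E E']]]; assert (K := chain_fs Hn); apply in_fs in K.
    destruct K as [_ K]; exact (funs_unique K E E'). }
  destruct (chain_total Hk Hm) as [L | L]; [exists m | exists k]; repeat split;
    auto; now apply L.
Qed.

Lemma chain_sub_lim k : k ∈ om -> included (app F k) (lim B F).
Proof. intros Hk p Hp; apply in_lim; eauto. Qed.

End Limits.

End Arithmetic.

#[export] Hint Extern 1 (dfnt (fun e => least _)) => simple apply dfnt_least : dfn.
#[export] Hint Extern 1 (dfnt (fun e => rec _ _ _)) => simple apply dfnt_rec : dfn.
#[export] Hint Extern 1 (dfnt (fun e => fs _)) => simple apply dfnt_fs : dfn.
#[export] Hint Extern 1 (dfnt (fun e => snoc _ _)) => simple apply dfnt_snoc : dfn.
#[export] Hint Extern 1 (dfnt (fun e => res _ _)) => simple apply dfnt_res : dfn.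
#[export] Hint Extern 1 (dfnt (fun e => lim _ _)) => simple apply dfnt_lim : dfn.

(** * Arithmetic and the coding of finite sequences *)

Section Coding.
Context {V : set_structure} {HZF : ZF V}.
Implicit Types a b c f n m k p s t x y z A B : V.

Lemma app_default f x : (forall y, ~ opair x y ∈ f) -> app f x = zero.
Proof.
intros H; apply set_ext; intros z; unfold app; rewrite in_sep by dfn; split.
- intros [_ [y [K _]]]; now apply H in K.
- intros K; now apply in_zero in K.
Qed.

Lemma app_fs_om t n : t ∈ fs om -> app t n ∈ om.
Proof.
intros Ht; apply in_fs in Ht; destruct Ht as [_ Ht].
destruct (classic (n ∈ dom t)) as [H | H]; [exact (app_funs Ht H)|].
rewrite app_default; [apply zero_om|].
intros y Hy; apply H, in_dom; eauto.
Qed.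

Definition dbl n : V := app (rec om zero (fun _ x => succ (succ x))) n.

Lemma dfnt_dbl (t : (nat -> V) -> V) : dfnt t -> dfnt (fun e => dbl (t e)).
Proof. intros; unfold dbl; dfn. Qed.
#[local] Hint Extern 1 (dfnt (fun e => dbl _)) => simple apply dfnt_dbl : dfn.

Lemma dbl_zero : dbl zero = zero.
Proof. apply rec_zero; auto using zero_om, succ_om; dfn. Qed.

Lemma dbl_succ n : n ∈ om -> dbl (succ n) = succ (succ (dbl n)).
Proof.
apply (@rec_succ _ _ om zero (fun _ x => succ (succ x)));
  auto using zero_om, succ_om; dfn.
Qed.

Lemma dbl_om n : n ∈ om -> dbl n ∈ om.
Proof.
revert n; om_induction.
- rewrite dbl_zero; apply zero_om.
- intros n Hn IH; rewrite dbl_succ; auto using succ_om.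
Qed.

Lemma dbl_inj : forall n, n ∈ om -> forall m, m ∈ om -> dbl n = dbl m -> n = m.
Proof.
om_induction.
- intros m Hm; destruct (om_case Hm) as [-> | [k [Hk ->]]]; auto.
  rewrite dbl_zero, dbl_succ; auto; intros H; symmetry in H; now apply succ_neq_zero in H.
- intros n Hn IH m Hm; destruct (om_case Hm) as [-> | [k [Hk ->]]];
    rewrite ?dbl_zero, ?dbl_succ; auto; intros H; [now apply succ_neq_zero in H|].
  apply succ_inj, succ_inj in H; auto using dbl_om, succ_om; f_equal; auto.
Qed.

Lemma dbl_neq_succ : forall n, n ∈ om -> forall m, m ∈ om -> dbl n <> succ (dbl m).
Proof.
om_induction.
- intros m Hm; rewrite dbl_zero; intros H; symmetry in H; now apply succ_neq_zero in H.
- intros n Hn IH m Hm; rewrite dbl_succ by auto; intros H.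
  apply succ_inj in H; auto using dbl_om, succ_om.
  destruct (om_case Hm) as [-> | [k [Hk ->]]].
  + rewrite dbl_zero in H; now apply succ_neq_zero in H.
  + rewrite dbl_succ in H by auto; apply succ_inj in H; auto using dbl_om, succ_om.
    now apply (IH k).
Qed.

Lemma parity : forall n, n ∈ om -> exists m, m ∈ om /\ (n = dbl m \/ n = succ (dbl m)).
Proof.
om_induction.
- exists zero; rewrite dbl_zero; auto using zero_om.
- intros n Hn [m [Hm [-> | ->]]]; [exists m; auto|].
  exists (succ m); rewrite dbl_succ; auto using succ_om.
Qed.

(** Evenness means membership in all sets that contain zero and are closed under adding two. The
    doubles form one such set and lie in every other. *)
Lemma evenE n : even n <-> exists m, m ∈ om /\ n = dbl m.
Proof.
split.
- intros [Hn H]; rewrite omegaE in Hn.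
  enough (K : n ∈ sep om (fun n => exists m, m ∈ om /\ n = dbl m))
    by now (apply in_sep in K; [|dfn]).
  apply H.
  + intros z Hz; apply is_emptyE in Hz; subst; rewrite in_sep by dfn.
    split; [apply zero_om | exists zero; rewrite dbl_zero; auto using zero_om].
  + intros m m' m'' Hm E E'; rewrite is_succE in E, E'; subst.
    rewrite in_sep in Hm by dfn; destruct Hm as [_ [k [Hk ->]]].
    rewrite in_sep by dfn; rewrite <- dbl_succ by auto.
    split; [|exists (succ k)]; auto using dbl_om, succ_om.
- intros [m [Hm ->]]; split; [now rewrite omegaE; apply dbl_om|].
  intros I H0 HS; revert m Hm; om_induction.
  + rewrite dbl_zero; now apply H0, is_emptyE.
  + intros n Hn IH; rewrite dbl_succ by auto.
    now apply (HS (dbl n) (succ (dbl n))); [|apply is_succE|apply is_succE].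
Qed.

Lemma oddE n : odd n <-> exists m, m ∈ om /\ n = succ (dbl m).
Proof.
unfold odd; rewrite evenE, omegaE; split.
- intros [Hn H]; destruct (parity Hn) as [m [Hm [E | E]]]; [|eauto].
  exfalso; eauto.
- intros [m [Hm ->]]; split; [auto using dbl_om, succ_om|].
  intros [k [Hk E]]; symmetry in E; now apply dbl_neq_succ in E.
Qed.

Lemma dbl_lt : forall n, n ∈ om -> forall m, m ∈ n -> succ (dbl m) ∈ dbl n.
Proof.
om_induction.
- intros m Hm; now apply in_zero in Hm.
- intros n Hn IH m Hm; rewrite dbl_succ by auto.
  apply in_succ in Hm; destruct Hm as [Hm | ->]; [|apply mem_succ].
  now apply mem_succ_of_mem, mem_succ_of_mem, IH.
Qed.

Lemma dbl_mono n m : n ∈ om -> m ∈ n -> dbl m ∈ dbl n.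
Proof.
intros Hn H; apply (mem_trans (dbl_om Hn) (dbl_lt Hn H)), mem_succ.
Qed.

Lemma dbl_mono_inv n m : n ∈ om -> m ∈ om -> dbl m ∈ dbl n -> m ∈ n.
Proof.
intros Hn Hm H; destruct (mem_total Hn Hm) as [K | [-> | K]]; auto.
- now apply mem_irrefl in H.
- now destruct (mem_asym (dbl_om Hn) H (dbl_mono Hm K)).
Qed.

Lemma dbl_le_inv n m : n ∈ om -> m ∈ om -> dbl m ∈ succ (dbl n) -> m ∈ succ n.
Proof.
intros Hn Hm H; apply in_succ in H; apply in_succ; destruct H as [H | H].
- left; now apply dbl_mono_inv.
- right; now apply dbl_inj.
Qed.

Lemma dbl_lt_inv n m : n ∈ om -> m ∈ om -> succ (dbl m) ∈ dbl n -> m ∈ n.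
Proof.
intros Hn Hm H; apply dbl_mono_inv; auto.
exact (mem_trans (dbl_om Hn) H (mem_succ _)).
Qed.

Definition add k n : V := app (rec om k (fun _ x => succ x)) n.

Lemma dfnt_add (s t : (nat -> V) -> V) :
  dfnt s -> dfnt t -> dfnt (fun e => add (s e) (t e)).
Proof. intros; unfold add; dfn. Qed.

Lemma add_zero k : k ∈ om -> add k zero = k.
Proof. intros Hk; apply (@rec_zero _ _ om k (fun _ x => succ x)); auto using succ_om; dfn. Qed.

Lemma add_succ k n : k ∈ om -> n ∈ om -> add k (succ n) = succ (add k n).
Proof.
intros Hk; apply (@rec_succ _ _ om k (fun _ x => succ x)); auto using succ_om; dfn.
Qed.

#[local] Hint Extern 1 (dfnt (fun e => add _ _)) => simple apply dfnt_add : dfn.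

Lemma add_om k n : k ∈ om -> n ∈ om -> add k n ∈ om.
Proof.
intros Hk; revert n; om_induction; [now rewrite add_zero|].
intros n Hn IH; rewrite add_succ; auto using succ_om.
Qed.

Lemma add_ge k n : k ∈ om -> n ∈ om -> k ∈ succ (add k n).
Proof.
intros Hk; revert n; om_induction; [rewrite add_zero; auto using mem_succ|].
intros n Hn IH; rewrite add_succ by auto; now apply mem_succ_of_mem.
Qed.

(** This is [2^m (2n + 1)], an injective pairing that requires no more than doubling. *)
Definition pair m n : V := app (rec om (succ (dbl n)) (fun _ x => dbl x)) m.

Lemma dfnt_pair (s t : (nat -> V) -> V) :
  dfnt s -> dfnt t -> dfnt (fun e => pair (s e) (t e)).
Proof. intros; unfold pair; dfn. Qed.
#[local] Hint Extern 1 (dfnt (fun e => pair _ _)) => simple apply dfnt_pair : dfn.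

Lemma pair_zero n : n ∈ om -> pair zero n = succ (dbl n).
Proof. intros Hn; apply (@rec_zero _ _ om (succ (dbl n)) (fun _ x => dbl x)); auto using succ_om, dbl_om; dfn. Qed.

Lemma pair_succ m n : m ∈ om -> n ∈ om -> pair (succ m) n = dbl (pair m n).
Proof.
intros Hm Hn; apply (@rec_succ _ _ om (succ (dbl n)) (fun _ x => dbl x));
  auto using succ_om, dbl_om; dfn.
Qed.

Lemma pair_om m n : m ∈ om -> n ∈ om -> pair m n ∈ om.
Proof.
intros Hm Hn; revert m Hm; om_induction.
- rewrite pair_zero; auto using succ_om, dbl_om.
- intros m Hm IH; rewrite pair_succ; auto using dbl_om.
Qed.

Lemma pair_inj : forall m, m ∈ om -> forall m' n n', m' ∈ om -> n ∈ om -> n' ∈ om ->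
  pair m n = pair m' n' -> m = m' /\ n = n'.
Proof.
om_induction.
- intros m' n n' Hm' Hn Hn'; rewrite pair_zero by auto.
  destruct (om_case Hm') as [-> | [k [Hk ->]]].
  + rewrite pair_zero by auto; intros H.
    apply succ_inj, dbl_inj in H; auto using dbl_om.
  + rewrite pair_succ by auto; intros H; symmetry in H.
    apply dbl_neq_succ in H; auto using pair_om; tauto.
- intros m Hm IH m' n n' Hm' Hn Hn'; rewrite pair_succ by auto.
  destruct (om_case Hm') as [-> | [k [Hk ->]]].
  + rewrite pair_zero by auto; intros H.
    apply dbl_neq_succ in H; auto using pair_om; tauto.
  + rewrite pair_succ by auto; intros H; apply dbl_inj in H; auto using pair_om.
    destruct (IH k n n') as [-> ->]; auto.
Qed.

(** The value at [n] codes the first [n] entries of [t]: each step pairs the code so far with the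
    next entry. The [succ] keeps codes of nonempty sequences apart from [zero], the code of the
    empty one, so that a code determines the length. *)
Definition code_rec t : V := rec om zero (fun n x => succ (pair x (app t n))).
Definition code t : V := app (code_rec t) (dom t).

Lemma dfnt_code_rec (t : (nat -> V) -> V) : dfnt t -> dfnt (fun e => code_rec (t e)).
Proof. intros; unfold code_rec; dfn. Qed.
#[local] Hint Extern 1 (dfnt (fun e => code_rec _)) => simple apply dfnt_code_rec : dfn.

Lemma dfnt_code (t : (nat -> V) -> V) : dfnt t -> dfnt (fun e => code (t e)).
Proof. intros; unfold code; dfn. Qed.
#[local] Hint Extern 1 (dfnt (fun e => code _)) => simple apply dfnt_code : dfn.

Section CodeRec.
Variable t : V.
Hypothesis Ht : t ∈ fs om.

Let step n x : n ∈ om -> x ∈ om -> succ (pair x (app t n)) ∈ om.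
Proof. auto using succ_om, pair_om, app_fs_om. Qed.

Lemma code_rec_funs : code_rec t ∈ funs om om.
Proof. apply rec_funs; auto using zero_om; dfn. Qed.

Lemma code_rec_zero : app (code_rec t) zero = zero.
Proof. apply rec_zero; auto using zero_om; dfn. Qed.

Lemma code_rec_succ n : n ∈ om ->
  app (code_rec t) (succ n) = succ (pair (app (code_rec t) n) (app t n)).
Proof.
apply (@rec_succ _ _ om zero (fun n x => succ (pair x (app t n))));
  auto using zero_om; dfn.
Qed.

End CodeRec.

Lemma code_rec_om t n : t ∈ fs om -> n ∈ om -> app (code_rec t) n ∈ om.
Proof. intros Ht; exact (app_funs (code_rec_funs Ht)). Qed.

Lemma code_om t : t ∈ fs om -> code t ∈ om.
Proof. intros Ht; unfold code; apply code_rec_om; auto; now apply in_fs in Ht. Qed.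

(** The last entry is peeled off: equal codes are both [zero] or both successors of pairs, and
    pairing is injective. *)
Lemma code_rec_inj s t : s ∈ fs om -> t ∈ fs om ->
  forall n, n ∈ om -> forall m, m ∈ om -> app (code_rec s) n = app (code_rec t) m ->
  n = m /\ forall i, i ∈ n -> app s i = app t i.
Proof.
intros Hs Ht; om_induction.
- intros m Hm H; rewrite code_rec_zero in H by auto; split.
  + destruct (om_case Hm) as [-> | [k [Hk ->]]]; auto.
    rewrite code_rec_succ in H by auto; symmetry in H; now apply succ_neq_zero in H.
  + intros i Hi; now apply in_zero in Hi.
- intros n Hn IH m Hm H; rewrite code_rec_succ in H by auto.
  destruct (om_case Hm) as [-> | [k [Hk ->]]].
  + rewrite code_rec_zero in H by auto; now apply succ_neq_zero in H.
  + rewrite code_rec_succ in H by auto.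
    apply succ_inj, pair_inj in H; auto using pair_om, code_rec_om, app_fs_om.
    destruct H as [H E]; apply IH in H; auto; destruct H as [-> H].
    split; auto; intros i Hi; apply in_succ in Hi; destruct Hi as [Hi | ->]; auto.
Qed.

Lemma code_inj s t : s ∈ fs om -> t ∈ fs om -> code s = code t -> s = t.
Proof.
intros Hs Ht H; destruct (proj1 (in_fs _ _) Hs) as [Ds _].
destruct (proj1 (in_fs _ _) Ht) as [Dt _].
destruct (code_rec_inj Hs Ht Ds Dt H); now apply (fs_ext Hs Ht).
Qed.

(* The union of the sequences with code [n]: it is [zero], the empty sequence,
   if [n] is not a code. *)
Definition dec n : V := bigcup (sep (fs om) (fun t => code t = n)).

Lemma dfnt_dec (t : (nat -> V) -> V) : dfnt t -> dfnt (fun e => dec (t e)).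
Proof. intros; unfold dec; dfn. Qed.

Lemma dec_code t : t ∈ fs om -> dec (code t) = t.
Proof.
intros Ht; apply set_ext; intros z; unfold dec; rewrite in_bigcup; split.
- intros [s [Hs Hz]]; rewrite in_sep in Hs by dfn; destruct Hs as [Hs E].
  apply code_inj in E; auto; now subst.
- intros Hz; exists t; rewrite in_sep by dfn; auto.
Qed.

Lemma dec_fs n : dec n ∈ fs om.
Proof.
destruct (classic (exists t, t ∈ fs om /\ code t = n)) as [[t [Ht <-]] | H].
- now rewrite dec_code.
- replace (dec n) with (zero (V := V)); [apply zero_fs|].
  symmetry; apply set_ext; intros z; split; intros K; [|now apply in_zero in K].
  unfold dec in K; apply in_bigcup in K; destruct K as [t [K _]].
  rewrite in_sep in K by dfn; now destruct H; exists t.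
Qed.

End Coding.
#[export] Hint Extern 1 (dfnt (fun e => dbl _)) => simple apply dfnt_dbl : dfn.
#[export] Hint Extern 1 (dfnt (fun e => add _ _)) => simple apply dfnt_add : dfn.
#[export] Hint Extern 1 (dfnt (fun e => dec _)) => simple apply dfnt_dec : dfn.

(** * Dependent and countable choice *)

Section Choice.
Context {V : set_structure} {HZF : ZF V}.
Hypothesis HDC : DC V.
Implicit Types a b c f n m k p s t x y z A B : V.

Lemma dependent_choice A (P : V -> V -> Prop) : dfn (fun e => P (e 1) (e 0)) ->
  (exists x, x ∈ A) -> (forall x, x ∈ A -> exists y, y ∈ A /\ P x y) ->
  exists f, f ∈ funs om A /\ forall n, n ∈ om -> P (app f n) (app f (succ n)).
Proof.
intros HP HA H.
destruct (@separation _ _ (fun p => exists x y, p = opair x y /\ P x y) (prod A A))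
  as [R HR']; [dfn|]; unfold is_set_of in HR'.
assert (HR : forall x y, x ∈ A -> y ∈ A -> (maps R x y <-> P x y)).
{ intros x y Hx Hy; rewrite mapsE, HR', opair_in_prod; split.
  - intros [_ [x' [y' [E K]]]]; apply opair_inj in E; destruct E; now subst.
  - intros K; split; eauto. }
destruct (HDC (R := R) HA) as [f [Hf K]].
{ intros x Hx; destruct (H x Hx) as [y [Hy Pxy]]; exists y; now rewrite HR. }
exists f; rewrite (is_funE (A := om) (B := A)) in Hf;
  [|apply omegaE|reflexivity].
split; auto; intros n Hn.
apply HR; try apply (app_funs Hf); auto using succ_om.
apply (K n (succ n)); rewrite ?omegaE, ?is_succE, ?mapsE; auto;
  apply (app_in_graph Hf); auto using succ_om.
Qed.

(** DC is applied to the finite sequences of correct choices, each related to those that make one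
    choice more. The union of the resulting chain is the choice function. *)
Lemma countable_choice B (P : V -> V -> Prop) : dfn (fun e => P (e 1) (e 0)) ->
  (forall n, n ∈ om -> exists y, y ∈ B /\ P n y) ->
  exists f, f ∈ funs om B /\ forall n, n ∈ om -> P n (app f n).
Proof.
intros HP H.
destruct (@separation _ _ (fun t => forall n, n ∈ dom t -> P n (app t n)) (fs B))
  as [A HA]; [dfn|]; unfold is_set_of in HA.
destruct (@dependent_choice A (fun s t => exists v, v ∈ B /\ t = snoc s v))
  as [F [HF K]].
{ dfn. }
{ exists zero; rewrite HA, dom_zero; split; [apply zero_fs|].
  intros n Hn; now apply in_zero in Hn. }
{ intros t Ht; apply HA in Ht; destruct Ht as [Ht Pt].
  destruct (H (dom t)) as [v [Hv Pv]]; [now apply in_fs in Ht|].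
  exists (snoc t v); split; [|eauto]; apply HA; split; [auto using snoc_fs|].
  intros n Hn; rewrite dom_snoc in Hn; apply in_succ in Hn; destruct Hn as [Hn | ->].
  - rewrite (app_snoc_init Ht Hv Hn); auto.
  - now rewrite (app_snoc_last Ht Hv). }
assert (HF' : F ∈ funs om (fs B)).
{ apply (funs_widen HF); intros n Hn; now apply HA, (app_funs HF). }
assert (HS : forall k, k ∈ om -> included (app F k) (app F (succ k)) /\
  dom (app F k) ∈ dom (app F (succ k))).
{ intros k Hk; destruct (K k Hk) as [v [Hv ->]]; rewrite dom_snoc.
  split; [apply sub_snoc | apply mem_succ]. }
exists (lim B F); split; [exact (lim_funs HF' HS)|]; intros n Hn.
assert (L := chain_lt HF' HS Hn (succ_om Hn) (mem_succ n)).
rewrite <- (@app_sub_fs _ _ B (app F (succ n)) (lim B F) n); auto.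
- apply HA; auto; apply (app_funs HF), succ_om, Hn.
- apply (chain_fs HF'), succ_om, Hn.
- right; apply (lim_funs HF' HS).
- apply (chain_sub_lim HF'), succ_om, Hn.
Qed.

End Choice.

(** * Bases of the topologies *)

Section Topologies.
Context {V : set_structure} {HZF : ZF V}.
Implicit Types a b c f h n m k p s t u x y z A B O U W Y TY : V.

(** The subsets of [A] that contain a member of [G] around each of their points form a topology
    which is a set of [V]. It includes [G], so every set of the generated topology belongs to it. *)
Lemma generated_topology_local (P : class V) A (G : class V) U :
  (forall x, P x <-> x ∈ A) -> dfn (fun e => G (e 0)) ->
  (forall O, G O -> included O A) ->
  (forall x, x ∈ A -> exists O, G O /\ x ∈ O) ->
  (forall O O' x, G O -> G O' -> x ∈ O -> x ∈ O' ->
    exists W, G W /\ x ∈ W /\ included W O /\ included W O') ->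
  generated_topology P G U ->
  included U A /\ forall x, x ∈ U -> exists O, G O /\ x ∈ O /\ included O U.
Proof.
intros HP HG GA Gcover Gmeet HU.
destruct (@separation _ _ (fun U => forall x, x ∈ U ->
  exists O, G O /\ x ∈ O /\ included O U) (pow A)) as [S HS]; [dfn|].
unfold is_set_of in HS.
assert (HS' : forall O, O ∈ S <-> included O A /\ forall x, x ∈ O ->
  exists O', G O' /\ x ∈ O' /\ included O' O) by (intros O; now rewrite HS, in_pow).
enough (K : U ∈ S) by now apply HS'.
apply HU; [|intros O HO; apply HS'; split; [now apply GA|]; intros x Hx; exists O;
  auto using included_refl].
repeat split.
- intros O HO z Hz; apply HS' in HO; now apply HP, HO.
- intros O HO; apply HS'; split; [intros z Hz; now apply HP, HO|].
  intros x Hx; apply HO, HP in Hx; destruct (Gcover x Hx) as [O' [H1 H2]].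
  exists O'; repeat split; auto; intros z Hz; apply HO, HP; now apply (GA O').
- intros F W HF HW; apply HS'; split.
  + intros z Hz; apply HW in Hz; destruct Hz as [O [HO Hz]].
    apply HF, HS' in HO; now apply HO.
  + intros x Hx; apply HW in Hx; destruct Hx as [O [HO Hx]].
    destruct (proj2 (proj1 (HS' O) (HF O HO)) x Hx) as [O' [H1 [H2 H3]]].
    exists O'; repeat split; auto; intros z Hz; apply HW; exists O.
    split; [exact HO | now apply H3].
- intros O O' W HO HO' HW; apply HS' in HO, HO'; apply HS'; split.
  + intros z Hz; apply HW in Hz; destruct Hz; now apply HO.
  + intros x Hx; apply HW in Hx; destruct Hx as [Hx Hx'].
    destruct (proj2 HO x Hx) as [B [B1 [B2 B3]]].
    destruct (proj2 HO' x Hx') as [B' [B1' [B2' B3']]].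
    destruct (Gmeet B B' x) as [C [C1 [C2 [C3 C4]]]]; auto.
    exists C; repeat split; auto; intros z Hz; apply HW.
    split; [now apply B3, C3 | now apply B3', C4].
Qed.

Lemma cylinderE t b : cylinder t b <-> b ∈ funs om om /\ included t b.
Proof. unfold cylinder; now rewrite baireE. Qed.

Lemma baire_topologyE U : baire_topology U <-> included U (funs om om) /\
  forall b, b ∈ U -> exists t, t ∈ fs om /\ included t b /\
    forall b', b' ∈ funs om om -> included t b' -> b' ∈ U.
Proof.
split.
- intros H.
  apply (generated_topology_local (A := funs om om)) in H; [| apply baireE | | | | ].
  + destruct H as [H K]; split; auto; intros b Hb.
    destruct (K b Hb) as [O [[t [Ht HO]] [Ob OU]]]; exists t.
    apply HO, cylinderE in Ob; rewrite <- finseqE; repeat split; [auto | apply Ob |].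
    intros b' Hb' L; apply OU, HO; now apply cylinderE.
  + apply (@dfn_ext _ (fun e => exists t, t ∈ fs om /\
      forall b, b ∈ e 0 <-> b ∈ funs om om /\ included t b)); [|dfn].
    intros e; split; intros [t [Ht HO]]; exists t;
      rewrite finseqE in *; split; auto; intros b; rewrite (HO b), cylinderE; reflexivity.
  + intros O [t [Ht HO]] b Hb; now apply HO, cylinderE in Hb.
  + intros b Hb; exists (funs om om); split; auto; exists zero; split.
    * apply finseqE, zero_fs.
    * intros z; rewrite cylinderE; split; [|tauto].
      intros Hz; split; auto; intros p Hp; now apply in_zero in Hp.
  + intros O O' b [t [Ht HO]] [t' [Ht' HO']] Hb Hb'.
    rewrite finseqE in Ht, Ht'.
    pose proof (proj1 (HO b) Hb) as K; pose proof (proj1 (HO' b) Hb') as K'.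
    rewrite cylinderE in K, K'.
    (* Both sequences are initial segments of [b], so one extends the other, and the longer one has
       the smaller cylinder. *)
    assert (D : included t t' \/ included t' t).
    { assert (Dt := proj1 (proj1 (in_fs _ _) Ht)).
      assert (Dt' := proj1 (proj1 (in_fs _ _) Ht')).
      destruct (mem_total Dt' Dt) as [L | [L | L]].
      - left; apply (sub_comparable Ht Ht' (proj1 K)); try tauto; now apply mem_sub.
      - left; apply (sub_comparable Ht Ht' (proj1 K)); try tauto.
        rewrite L; apply included_refl.
      - right; apply (sub_comparable Ht' Ht (proj1 K)); try tauto; now apply mem_sub. }
    assert (L : forall O O' t t', is_set_of O (cylinder t) ->
      is_set_of O' (cylinder t') -> included t t' -> included O' O).
    { intros O1 O1' t1 t1' H1 H1' H2 z Hz; apply H1, cylinderE.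
      apply H1', cylinderE in Hz; split; [tauto|].
      exact (included_trans H2 (proj2 Hz)). }
    rewrite <- finseqE in Ht, Ht'; destruct D as [D | D].
    * exists O'; split; [now exists t'|]; repeat split; auto using included_refl.
      exact (L O O' t t' HO HO' D).
    * exists O; split; [now exists t|]; repeat split; auto using included_refl.
      exact (L O' O t' t HO' HO D).
- intros [HU K] S [_ [_ [HS _]]] HG.
  (* [U] is written as the union of all members of [S] inside it, so no cylinder has to be chosen
     for each point. *)
  apply (HS (sep S (fun O => included O U))).
  + intros O HO; now apply in_sep in HO; [|dfn].
  + intros z; split.
    * intros Hz; destruct (K z Hz) as [t [Ht [tz tU]]].
      exists (sep (funs om om) (fun b => included t b)); split.
      -- apply in_sep; [dfn|]; split.
         ++ apply HG; exists t; rewrite finseqE; split; auto; intros b.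
            rewrite cylinderE; apply (@in_sep _ _ _ (fun b => included t b)); dfn.
         ++ intros b Hb; apply in_sep in Hb; [|dfn]; now apply tU.
      -- apply in_sep; [dfn|]; split; [now apply HU | auto].
    * intros [O [HO Hz]]; apply in_sep in HO; [|dfn]; now apply HO.
Qed.

Lemma is_open_boxE Y TY B : is_open_box Y TY B <->
  exists u, u ∈ funs om TY /\ forall s, s ∈ B <-> s ∈ funs om Y /\
    forall n, n ∈ om -> app s n ∈ app u n.
Proof.
assert (E : forall s, seqs Y s <-> s ∈ funs om Y)
  by (intros s; apply is_funE; [apply omegaE | reflexivity]).
unfold is_open_box.
enough (K : forall u, u ∈ funs om TY -> forall s, (seqs Y s /\
  (forall n O x, maps u n O -> maps s n x -> x ∈ O)) <-> (s ∈ funs om Y /\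
  forall n, n ∈ om -> app s n ∈ app u n)).
{ split; intros [u [Hu H]]; exists u;
    rewrite (is_funE (A := om) (B := TY)) in *; try apply omegaE; try reflexivity;
    (split; [auto|]); intros s; rewrite (H s), (K u Hu); reflexivity. }
intros u Hu s; rewrite E; split; intros [Hs H]; split; auto.
- intros n Hn; apply (H n); apply mapsE; [now apply (app_in_graph Hu) |
    now apply (app_in_graph Hs)].
- intros n O x; rewrite !mapsE, (funs_maps _ _ Hu), (funs_maps _ _ Hs).
  intros [Hn ->] [_ ->]; auto.
Qed.

(** Boxes form a base because two of them can be intersected coordinate by coordinate. The
    neighbourhoods of all coordinates of [h] come in a single sequence, so none has to be chosen
    later. *)
Lemma box_open_local Y TY H h : is_topology Y TY -> box_open Y TY H -> h ∈ H ->
  exists u, u ∈ funs om TY /\ (forall n, n ∈ om -> app h n ∈ app u n) /\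
    forall s, s ∈ funs om Y -> (forall n, n ∈ om -> app s n ∈ app u n) -> s ∈ H.
Proof.
intros [_ [Ytop [_ Tmeet]]] HH Hh.
assert (TYY : Y ∈ TY) by (apply Ytop; intros z; reflexivity).
apply (generated_topology_local (A := funs om Y)) in HH.
- destruct HH as [_ K]; destruct (K h Hh) as [B [HB [Bh BH]]].
  apply is_open_boxE in HB; destruct HB as [u [Hu HB]]; exists u; split; [auto|split].
  + now apply HB.
  + intros s Hs K'; apply BH, HB; auto.
- intros s; apply is_funE; [apply omegaE | reflexivity].
- eapply dfn_ext; [intros e; symmetry; apply is_open_boxE|]; dfn.
- intros B HB s Hs; apply is_open_boxE in HB; destruct HB as [u [_ HB]]; now apply HB.
- intros s Hs; exists (funs om Y); split; auto; apply is_open_boxE.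
  assert (Hc : dfnt (fun _ : nat -> V => Y)) by dfn.
  exists (lam om TY (fun _ => Y)); split; [apply lam_funs; auto|].
  intros s'; split; [|tauto]; intros Hs'; split; auto; intros n Hn.
  rewrite app_lam by auto; now apply (app_funs Hs').
- intros B B' s HB HB' Hs Hs'; apply is_open_boxE in HB, HB'.
  destruct HB as [u [Hu HB]], HB' as [u' [Hu' HB']].
  pose (w n := sep (app u n) (fun x => x ∈ app u' n)).
  assert (Hw : forall n, n ∈ om -> w n ∈ TY).
  { intros n Hn; apply (Tmeet (app u n) (app u' n)).
    - exact (app_funs Hu Hn).
    - exact (app_funs Hu' Hn).
    - intros z; apply (@in_sep _ _ _ (fun x => x ∈ app u' n)); dfn. }
  assert (Dw : dfnt (fun e : nat -> V => w (e 0))) by (unfold w; dfn).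
  assert (Ew : forall n, n ∈ om -> app (lam om TY w) n = w n)
    by (intros; now apply app_lam).
  assert (Iw : forall n x, x ∈ w n <-> x ∈ app u n /\ x ∈ app u' n)
    by (intros n x; apply (@in_sep _ _ _ (fun x => x ∈ app u' n)); dfn).
  exists (sep (funs om Y) (fun s => forall n, n ∈ om -> app s n ∈ app (lam om TY w) n)).
  assert (L : forall s, s ∈ sep (funs om Y) (fun s => forall n, n ∈ om ->
    app s n ∈ app (lam om TY w) n) <-> s ∈ funs om Y /\ forall n, n ∈ om ->
    app s n ∈ app (lam om TY w) n)
    by (intros s'; apply (@in_sep _ _ _ (fun s => forall n, n ∈ om ->
      app s n ∈ app (lam om TY w) n)); dfn).
  repeat split.
  + apply is_open_boxE; exists (lam om TY w); split; [now apply lam_funs|]; exact L.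
  + apply L; apply HB in Hs; apply HB' in Hs'; split; [tauto|].
    intros n Hn; rewrite Ew, Iw by auto; split; [now apply Hs | now apply Hs'].
  + intros z Hz; apply L in Hz; apply HB; destruct Hz as [Hz K]; split; auto.
    intros n Hn; specialize (K n Hn); rewrite Ew, Iw in K by auto; tauto.
  + intros z Hz; apply L in Hz; apply HB'; destruct Hz as [Hz K]; split; auto.
    intros n Hn; specialize (K n Hn); rewrite Ew, Iw in K by auto; tauto.
Qed.

End Topologies.

(** * Positions of the game *)

Section Positions.
Context {V : set_structure} {HZF : ZF V}.
Implicit Types a b c f g i h n m k p q s t u v w x y z A B F : V.

(* Player I's move in round [k], at [dbl k], is the code of a finite sequence,
   and player II accepts it by a nonzero move at [succ (dbl k)]. Since [app] is
   [zero] outside the domain, nothing is accepted beyond the end of a position. *)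
Definition acc b k : Prop := app b (succ (dbl k)) <> zero.

(** In general only a relation, since accepted sequences may contradict each other. That it be a
    point of [C] is demanded by the payoff. *)
Definition cov b : V :=
  sep (prod om om) (fun w => exists k, k ∈ om /\ acc b k /\ w ∈ dec (app b (dbl k))).

Lemma dfn_acc (s t : (nat -> V) -> V) :
  dfnt s -> dfnt t -> dfn (fun e => acc (s e) (t e)).
Proof. intros; unfold acc; dfn. Qed.
#[local] Hint Extern 1 (dfn (fun e => acc _ _)) => simple apply dfn_acc : dfn.

Lemma dfnt_cov (t : (nat -> V) -> V) : dfnt t -> dfnt (fun e => cov (t e)).
Proof. intros; unfold cov; dfn. Qed.
#[local] Hint Extern 1 (dfnt (fun e => cov _)) => simple apply dfnt_cov : dfn.

Lemma in_cov b w :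
  w ∈ cov b <-> exists k, k ∈ om /\ acc b k /\ w ∈ dec (app b (dbl k)).
Proof.
unfold cov; rewrite in_sep by dfn; split; [tauto|].
intros [k [Hk [H Hw]]]; split; [|eauto].
destruct (proj1 (in_fs _ _) (dec_fs (app b (dbl k)))) as [D K].
destruct (in_fun K Hw) as [x [Hx [Hy ->]]]; apply opair_in_prod; split; auto.
now apply (om_trans D).
Qed.

Definition round p a v : V := snoc (snoc p a) v.

Lemma dfnt_round (s t r : (nat -> V) -> V) :
  dfnt s -> dfnt t -> dfnt r -> dfnt (fun e => round (s e) (t e) (r e)).
Proof. intros; unfold round; dfn. Qed.

Lemma acc_dom p k i : p ∈ fs om -> dom p = dbl k -> k ∈ om -> i ∈ om -> acc p i -> i ∈ k.
Proof.
intros Hp D Hk Hi H.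
destruct (classic (succ (dbl i) ∈ dom p)) as [K | K].
- rewrite D in K; now apply dbl_lt_inv.
- exfalso; apply H, app_default; intros y Hy; apply K, in_dom; eauto.
Qed.

Lemma cov_zero : cov zero = zero.
Proof.
apply set_ext; intros w; split; intros H; [|now apply in_zero in H].
apply in_cov in H; destruct H as [k [_ [K _]]]; exfalso; apply K, app_default.
intros y; apply in_zero.
Qed.

Section Extensions.
Variables (A p b : V).
Hypothesis (Hp : p ∈ fs om) (Hb : b ∈ funs A om) (pb : included p b).

Lemma app_ext i : i ∈ dom p -> app p i = app b i.
Proof. intros Hi; apply in_fs in Hp; now apply (app_sub (proj2 Hp) Hb pb). Qed.

Lemma res_ext n : n ∈ dom p -> res p n = res b n.
Proof.
intros Hn; destruct (proj1 (in_fs _ _) Hp) as [D Fp].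
apply set_ext; intros w; rewrite !in_res; split; intros [H [x [y [Hx ->]]]];
  (split; [|eauto]).
- now apply pb.
- assert (K := app_in_graph Fp (mem_trans D Hn Hx)).
  now rewrite (funs_unique Hb H (pb K)).
Qed.

(** Acceptance is a nonzero reply, which the default value [zero] cannot supply. So both moves of an
    accepted round lie inside [p] and are inherited by [b]. *)
Lemma acc_mono i : i ∈ om -> acc p i -> acc b i /\ app p (dbl i) = app b (dbl i).
Proof.
intros Hi H; destruct (classic (succ (dbl i) ∈ dom p)) as [K | K].
- unfold acc in *; rewrite (app_ext K) in H; split; auto; apply app_ext.
  apply (mem_trans (proj1 (proj1 (in_fs _ _) Hp)) K), mem_succ.
- exfalso; apply H, app_default; intros y Hy; apply K, in_dom; eauto.
Qed.

Lemma acc_restrict k i : k ∈ om -> dom p = dbl k -> i ∈ k -> acc b i -> acc p i.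
Proof.
intros Hk D Hi H; unfold acc; rewrite app_ext; auto.
rewrite D; now apply dbl_lt.
Qed.

Lemma cov_mono : included (cov p) (cov b).
Proof.
intros w W; apply in_cov in W; apply in_cov; destruct W as [k [Hk [H Hw]]].
destruct (acc_mono Hk H) as [K E]; exists k; now rewrite <- E.
Qed.

End Extensions.

Section Round.
Variables (p k a v : V).
Hypothesis (Hp : p ∈ fs om) (Hk : k ∈ om) (D : dom p = dbl k) (Ha : a ∈ om) (Hv : v ∈ om).

Lemma round_fs : round p a v ∈ fs om.
Proof. now unfold round; apply snoc_fs; [apply snoc_fs|]. Qed.

Lemma round_funs : round p a v ∈ funs (dom (round p a v)) om.
Proof. exact (proj2 (proj1 (in_fs _ _) round_fs)). Qed.

Lemma dom_round : dom (round p a v) = dbl (succ k).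
Proof. unfold round; now rewrite !dom_snoc, dbl_succ, D. Qed.

Lemma dom_round_lt : dom p ∈ dom (round p a v).
Proof. unfold round; rewrite !dom_snoc; apply mem_succ_of_mem, mem_succ. Qed.

Lemma snoc_sub_round : included (snoc p a) (round p a v).
Proof. apply sub_snoc. Qed.

Lemma sub_round : included p (round p a v).
Proof. apply (included_trans (@sub_snoc _ _ p a) snoc_sub_round). Qed.

Lemma app_round_fst : app (round p a v) (dbl k) = a.
Proof.
rewrite <- D, <- (app_ext (snoc_fs Hp Ha) round_funs snoc_sub_round).
- now rewrite (app_snoc_last Hp Ha).
- rewrite dom_snoc; apply mem_succ.
Qed.

Lemma app_round_snd : app (round p a v) (succ (dbl k)) = v.
Proof.
rewrite <- D, <- (dom_snoc p a); apply (app_snoc_last (B := om)); auto.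
now apply snoc_fs.
Qed.

Lemma res_full t : t ∈ fs om -> res t (dom t) = t.
Proof.
intros Ht; apply set_ext; intros w; rewrite in_res; split; [tauto|].
intros Hw; split; auto; apply in_fs in Ht.
destruct (in_fun (proj2 Ht) Hw) as [x [Hx [_ ->]]]; eauto.
Qed.

Lemma res_prefix t s : t ∈ fs om -> s ∈ fs om -> included t s -> res s (dom t) = t.
Proof.
intros Ht Hs H; rewrite <- (res_full Ht) at 2; apply set_ext; intros w.
apply in_fs in Ht, Hs; rewrite !in_res; split; intros [K [x [y [Hx ->]]]];
  (split; [|eauto]); [|now apply H].
assert (L := app_in_graph (proj2 Ht) Hx).
now rewrite (funs_unique (proj2 Hs) K (H _ L)).
Qed.

Lemma res_round_fst : res (round p a v) (dbl k) = p.
Proof. rewrite <- D; apply res_prefix; auto using round_fs, sub_round. Qed.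

Lemma res_round_snd : res (round p a v) (succ (dbl k)) = snoc p a.
Proof.
rewrite <- D, <- (dom_snoc p a).
apply res_prefix; auto using round_fs, snoc_sub_round, snoc_fs.
Qed.

Lemma acc_round i : i ∈ om -> (acc (round p a v) i <-> acc p i \/ (i = k /\ v <> zero)).
Proof.
intros Hi; split.
- intros H; assert (K := acc_dom round_fs dom_round (succ_om Hk) Hi H).
  apply in_succ in K; destruct K as [K | ->].
  + left; exact (acc_restrict Hp round_funs sub_round Hk D K H).
  + right; split; auto; unfold acc in H; now rewrite app_round_snd in H.
- intros [H | [-> H]].
  + exact (proj1 (acc_mono Hp round_funs sub_round Hi H)).
  + unfold acc; now rewrite app_round_snd.
Qed.

Lemma in_cov_round w :
  w ∈ cov (round p a v) <-> w ∈ cov p \/ (v <> zero /\ w ∈ dec a).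
Proof.
split.
- rewrite in_cov; intros [i [Hi [H Hw]]]; apply acc_round in H; auto.
  destruct H as [H | [-> H]].
  + left; apply in_cov; exists i; repeat split; auto.
    now rewrite (proj2 (acc_mono Hp round_funs sub_round Hi H)).
  + right; now rewrite app_round_fst in Hw.
- intros [H | [H Hw]].
  + exact (cov_mono Hp round_funs sub_round H).
  + apply in_cov; exists k; rewrite acc_round, app_round_fst; auto.
Qed.

End Round.
Arguments sub_round : clear implicits.

(* The moves of player I are those at [g i] with [g = dbl], the moves of player II
   those with [g = fun i => succ (dbl i)]. *)
Definition consistent s (g : V -> V) : V :=
  sep (fs om) (fun p => exists k, k ∈ om /\ dom p = dbl k /\
    forall i, i ∈ k -> app p (g i) = app s (res p (g i))).

Section Chains.
Variable F : V.
Hypothesis HF : F ∈ funs om (fs om).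
Hypothesis HS : forall k, k ∈ om -> included (app F k) (app F (succ k)) /\
  dom (app F k) ∈ dom (app F (succ k)).

Lemma acc_lim i : i ∈ om -> acc (lim om F) i -> exists n, n ∈ om /\ acc (app F n) i.
Proof.
intros Hi H; set (n := succ (dbl i)).
assert (Hn : n ∈ om) by (apply succ_om, dbl_om, Hi).
exists (succ n); split; [now apply succ_om|].
unfold acc; rewrite (app_ext (chain_fs HF (succ_om Hn)) (lim_funs HF HS)); auto.
- exact (chain_sub_lim HF (succ_om Hn)).
- exact (chain_lt HF HS Hn (succ_om Hn) (mem_succ n)).
Qed.

Lemma cov_lim w : w ∈ cov (lim om F) -> exists n, n ∈ om /\ w ∈ cov (app F n).
Proof.
intros Hw; apply in_cov in Hw; destruct Hw as [i [Hi [H Hw]]].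
destruct (acc_lim Hi H) as [n [Hn K]]; exists n; split; auto.
apply in_cov; exists i; repeat split; auto.
now rewrite (proj2 (acc_mono (chain_fs HF Hn) (lim_funs HF HS) (chain_sub_lim HF Hn) Hi K)).
Qed.

(** Each entry of [t] is covered at some stage and the stages increase, so finitely many entries
    share a stage. Finiteness is meant in [V], hence the induction along [t]. *)
Lemma finite_sub_cov_lim t : t ∈ fs om -> included t (cov (lim om F)) ->
  exists k, k ∈ om /\ included t (cov (app F k)).
Proof.
apply (@fs_ind _ _ om (fun t => included t (cov (lim om F)) ->
  exists k, k ∈ om /\ included t (cov (app F k)))).
- dfn.
- intros _; exists zero; split; [exact zero_om|].
  intros w Hw; now apply in_zero in Hw.
- intros u v Hu Hv IH H.
  destruct IH as [k [Hk K]]; [exact (included_trans (@sub_snoc _ _ u v) H)|].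
  destruct (cov_lim (H _ (proj2 (in_snoc u v _) (or_intror eq_refl)))) as [m [Hm M]].
  assert (L : forall i j, i ∈ om -> j ∈ om -> included (app F i) (app F j) ->
    included (cov (app F i)) (cov (app F j))).
  { intros i j Hi Hj S; destruct (proj1 (in_fs _ _) (chain_fs HF Hj)) as [_ Hf].
    exact (cov_mono (chain_fs HF Hi) Hf S). }
  destruct (chain_total HS Hk Hm) as [S | S]; [exists m | exists k]; (split; [auto|]);
    intros w Hw; apply in_snoc in Hw; destruct Hw as [Hw | ->]; auto.
  + exact (L k m Hk Hm S _ (K w Hw)).
  + exact (L m k Hm Hk S _ M).
Qed.

(** A move and the position before it are already present at a sufficiently late stage, so obedience
    to [s] passes to the limit. The second condition on [g] says that the move at [g i] belongs to
    round [i]. *)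
Lemma consistent_lim s (g : V -> V) : dfnt (fun e => g (e 0)) ->
  (forall k i, k ∈ om -> i ∈ om -> (g i ∈ dbl k <-> i ∈ k)) ->
  (forall n, n ∈ om -> app F n ∈ consistent s g) ->
  forall i, i ∈ om -> app (lim om F) (g i) = app s (res (lim om F) (g i)).
Proof.
intros Dg Hg HC i Hi.
assert (Hgi : g i ∈ om).
{ apply (om_trans (dbl_om (succ_om Hi))), Hg; auto using succ_om, mem_succ. }
assert (K := HC _ (succ_om Hgi)); unfold consistent in K.
rewrite in_sep in K by dfn; destruct K as [Hp [k [Hk [D K]]]].
assert (L := chain_lt HF HS Hgi (succ_om Hgi) (mem_succ _)).
assert (pb := chain_sub_lim HF (succ_om Hgi)).
rewrite <- (app_ext Hp (lim_funs HF HS) pb L).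
rewrite <- (res_ext Hp (lim_funs HF HS) pb L).
apply K; rewrite D in L; exact (proj1 (Hg k i Hk Hi) L).
Qed.

End Chains.

Section Strategies.
Variable s : V.
Hypothesis Hs : s ∈ funs (fs om) om.

Lemma in_consistent (g : V -> V) p : dfnt (fun e => g (e 0)) ->
  (p ∈ consistent s g <-> p ∈ fs om /\ exists k, k ∈ om /\ dom p = dbl k /\
    forall i, i ∈ k -> app p (g i) = app s (res p (g i))).
Proof. intros; apply (@in_sep _ _ (fs om) (fun p => exists k, k ∈ om /\ dom p = dbl k /\
    forall i, i ∈ k -> app p (g i) = app s (res p (g i)))); dfn. Qed.

Lemma zero_consistent (g : V -> V) : dfnt (fun e => g (e 0)) -> zero ∈ consistent s g.
Proof.
intros Dg; apply in_consistent; auto; split; [apply zero_fs|].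
exists zero; rewrite dom_zero, dbl_zero; split; [apply zero_om|split; auto].
intros i Hi; now apply in_zero in Hi.
Qed.

Lemma consistent_sub (g : V -> V) p : dfnt (fun e => g (e 0)) ->
  p ∈ consistent s g -> p ∈ fs om /\ exists k, k ∈ om /\ dom p = dbl k.
Proof.
intros Dg Hp; apply in_consistent in Hp; auto.
destruct Hp as [H [k [Hk [D _]]]]; eauto.
Qed.

Lemma consistent_round (g : V -> V) p k a v : dfnt (fun e => g (e 0)) ->
  (forall k i, k ∈ om -> i ∈ k -> g i ∈ dbl k) ->
  p ∈ consistent s g -> k ∈ om -> dom p = dbl k -> a ∈ om -> v ∈ om ->
  app (round p a v) (g k) = app s (res (round p a v) (g k)) ->
  round p a v ∈ consistent s g.
Proof.
intros Dg Hg Hp Hk D Ha Hv H; apply in_consistent in Hp; auto.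
destruct Hp as [Hp [k' [Hk' [D' K]]]].
rewrite D in D'; apply dbl_inj in D'; auto; subst k'.
apply in_consistent; auto; split; [now apply round_fs|].
exists (succ k); split; [now apply succ_om|]; split; [now apply dom_round|].
intros i Hi; apply in_succ in Hi; destruct Hi as [Hi | ->]; auto.
assert (L : g i ∈ dom p) by (rewrite D; auto).
rewrite <- (app_ext Hp (round_funs Hp Ha Hv) (sub_round _ _ _) L).
rewrite <- (res_ext Hp (round_funs Hp Ha Hv) (sub_round _ _ _) L); auto.
Qed.

Lemma obeys_atE b n : b ∈ funs om om -> n ∈ om ->
  (obeys_at s b n <-> app b n = app s (res b n)).
Proof.
intros Hb Hn; unfold obeys_at; split.
- intros H; symmetry; apply (funs_maps n _ Hb), mapsE, (H (res b n)).
  + rewrite finseq_of_lengthE; split; [now apply res_fs | exact (dom_res Hb Hn)].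
  + apply res_sub.
  + apply mapsE, (app_in_graph Hs), res_fs; auto.
- intros H t i Ht tb; apply finseq_of_lengthE in Ht; destruct Ht as [Ht <-].
  rewrite !mapsE, (funs_maps _ _ Hs), (funs_maps _ _ Hb); intros [_ ->].
  split; auto; now rewrite H, <- (res_eq Ht Hb tb).
Qed.

End Strategies.

Lemma is_strategyE s : is_strategy s <-> s ∈ funs (fs om) om.
Proof. apply is_funE; [apply finseqE | apply omegaE]. Qed.

End Positions.
Arguments sub_round {V HZF} p a v.
#[export] Hint Extern 1 (dfn (fun e => acc _ _)) => simple apply dfn_acc : dfn.
#[export] Hint Extern 1 (dfnt (fun e => cov _)) => simple apply dfnt_cov : dfn.
#[export] Hint Extern 1 (dfnt (fun e => round _ _ _)) => simple apply dfnt_round : dfn.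

(** * The payoff set of the game *)

Section Payoff.
Context {V : set_structure} {HZF : ZF V}.
Variables (Y H X C f : V).
Implicit Types a b c i n m k p q s t u v w x y z A B F : V.

Definition unbounded b : Prop :=
  forall n, n ∈ om -> exists k, k ∈ om /\ ~ k ∈ n /\ acc b k.

(* The last accepting round of [b] is the one before round [k]. *)
Definition last_start b k : Prop :=
  (forall i, i ∈ om -> acc b i -> i ∈ k) /\
  (forall i, i ∈ om -> k = succ i -> acc b i).

(* From round [k] on, player I's moves in [b] code an open box whose image
   under [f] is included in [H]. *)
Definition boxed b k : Prop :=
  forall s, s ∈ funs om Y -> (forall m, m ∈ om -> exists c, c ∈ C /\
    included (dec (app b (dbl (add k m)))) c /\ app s m = app f c) -> s ∈ H.

Definition payoff : V :=
  sep (funs om om) (fun b => (unbounded b -> cov b ∈ C /\ app f (cov b) ∈ X) /\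
    forall k, k ∈ om -> last_start b k -> boxed b k).

Lemma in_payoff b : b ∈ payoff <-> b ∈ funs om om /\
  (unbounded b -> cov b ∈ C /\ app f (cov b) ∈ X) /\
    forall k, k ∈ om -> last_start b k -> boxed b k.
Proof.
apply (@in_sep _ _ (funs om om) (fun b =>
  (unbounded b -> cov b ∈ C /\ app f (cov b) ∈ X) /\
    forall k, k ∈ om -> last_start b k -> boxed b k)).
unfold unbounded, last_start, boxed; dfn.
Qed.

Lemma last_start_bounded b k : k ∈ om -> last_start b k -> ~ unbounded b.
Proof.
intros Hk [K _] U; destruct (U k Hk) as [i [Hi [L A]]]; auto.
Qed.

(** If [k] came before [k'], then [k'] would be a successor and the round just before it accepted,
    although [last_start b k] allows no accepted round from [k] on. *)
Lemma last_start_le b k k' : k ∈ om -> k' ∈ om ->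
  last_start b k -> last_start b k' -> ~ k ∈ k'.
Proof.
intros Hk Hk' [K _] [_ L] M; destruct (om_case Hk') as [-> | [i [Hi ->]]].
- now apply in_zero in M.
- assert (N := K i Hi (L i Hi eq_refl)); apply in_succ in M; destruct M as [M | ->].
  + exact (mem_asym Hi M N).
  + exact (mem_irrefl N).
Qed.

Lemma last_start_unique b k k' : k ∈ om -> k' ∈ om ->
  last_start b k -> last_start b k' -> k = k'.
Proof.
intros Hk Hk' L L'; destruct (mem_total Hk' Hk) as [M | [M | M]]; auto;
  exfalso; [eapply last_start_le in M | eapply last_start_le in M]; eauto.
Qed.

End Payoff.

(** * A winning strategy of player I yields a homomorphism *)

Section FirstPlayer.
Context {V : set_structure} {HZF : ZF V}.
Variables (Y TY H X C f s : V).
Implicit Types a b c i k m n p q t u v w x y z A B F : V.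
Hypothesis XY : included X Y.
Hypothesis f_continuous : forall O c, O ∈ TY -> c ∈ C -> app f c ∈ O ->
  exists t, t ∈ fs om /\ included t c /\
    forall c', c' ∈ C -> included t c' -> app f c' ∈ O.
Hypothesis (Hs : s ∈ funs (fs om) om).
Hypothesis s_wins : forall b, b ∈ funs om om ->
  (forall i, i ∈ om -> app b (dbl i) = app s (res b (dbl i))) ->
  b ∈ payoff Y H X C f.

Local Notation P := (consistent s dbl).

Let dbl_dfn : dfnt (fun e : nat -> V => dbl (e 0)).
Proof. dfn. Qed.

Lemma consistentI_fs p : p ∈ P -> p ∈ fs om /\ exists k, k ∈ om /\ dom p = dbl k.
Proof. now apply consistent_sub. Qed.

Definition answer p v : V := round p (app s p) v.

Lemma dfnt_answer (t r : (nat -> V) -> V) :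
  dfnt t -> dfnt r -> dfnt (fun e => answer (t e) (r e)).
Proof. intros; unfold answer; dfn. Qed.
#[local] Hint Extern 1 (dfnt (fun e => answer _ _)) => simple apply dfnt_answer : dfn.

Lemma answer_P p v : p ∈ P -> v ∈ om -> answer p v ∈ P.
Proof.
intros Hp Hv; destruct (consistentI_fs Hp) as [Fp [k [Hk D]]].
assert (Ha := app_funs Hs Fp).
unfold answer; apply (@consistent_round _ _ s dbl p k); auto.
{ intros; now apply dbl_mono. }
now rewrite (app_round_fst Fp D Ha Hv), (res_round_fst Fp D Ha Hv).
Qed.

(* In [app (iter p) n], player II rejects [n] times after [p]. *)
Definition iter p : V := rec P p (fun _ q => answer q zero).

Lemma dfnt_iter (t : (nat -> V) -> V) : dfnt t -> dfnt (fun e => iter (t e)).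
Proof. intros; unfold iter; dfn. Qed.
#[local] Hint Extern 1 (dfnt (fun e => iter _)) => simple apply dfnt_iter : dfn.

Section Iter.
Variables (p k : V).
Hypothesis (Hp : p ∈ P) (Hk : k ∈ om) (D : dom p = dbl k).

Lemma iter_funs : iter p ∈ funs om P.
Proof. apply rec_funs; [dfn | auto | auto using answer_P, zero_om]. Qed.

Lemma iter_zero : app (iter p) zero = p.
Proof.
apply (@rec_zero _ _ P p (fun _ q => answer q zero)); [dfn | auto | auto using answer_P, zero_om].
Qed.

Lemma iter_succ n : n ∈ om -> app (iter p) (succ n) = answer (app (iter p) n) zero.
Proof.
apply (@rec_succ _ _ P p (fun _ q => answer q zero)); [dfn | auto | auto using answer_P, zero_om].
Qed.

Lemma iter_P n : n ∈ om -> app (iter p) n ∈ P.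
Proof. exact (app_funs iter_funs). Qed.

Lemma iter_funs_fs : iter p ∈ funs om (fs om).
Proof. apply (funs_widen iter_funs); intros n Hn; now apply consistentI_fs, iter_P. Qed.

Lemma iter_chain n : n ∈ om -> included (app (iter p) n) (app (iter p) (succ n)) /\
  dom (app (iter p) n) ∈ dom (app (iter p) (succ n)).
Proof. intros Hn; rewrite iter_succ by auto; unfold answer.
split; [apply sub_round | apply dom_round_lt]. Qed.

Lemma dom_iter n : n ∈ om -> dom (app (iter p) n) = dbl (add k n).
Proof.
revert n; om_induction; [now rewrite iter_zero, add_zero|].
intros n Hn IH; rewrite iter_succ, add_succ by auto; unfold answer.
apply dom_round; auto using add_om.
Qed.

Lemma acc_iter n : n ∈ om -> forall i, i ∈ om -> acc (app (iter p) n) i -> acc p i.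
Proof.
revert n; om_induction; [now rewrite iter_zero|].
intros n Hn IH i Hi; rewrite iter_succ by auto; unfold answer; intros A.
assert (F := proj1 (consistentI_fs (iter_P Hn))).
apply (acc_round F (add_om Hk Hn) (dom_iter Hn) (app_funs Hs F) zero_om Hi) in A.
destruct A as [A | [_ A]]; auto; now destruct A.
Qed.

Lemma sub_iter n : n ∈ om -> included p (app (iter p) n).
Proof.
intros Hn; rewrite <- iter_zero at 1.
apply (chain_mono iter_chain Hn), zero_mem_succ, Hn.
Qed.

End Iter.

(** The limit obeys the strategy of player I at every round, hence is won by player I although
    player II never accepts after [p]. *)
Lemma rejected_payoff p : p ∈ P -> lim om (iter p) ∈ payoff Y H X C f.
Proof.
intros Hp; apply s_wins; [exact (lim_funs (iter_funs_fs Hp) (iter_chain Hp))|].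
apply (consistent_lim (iter_funs_fs Hp) (iter_chain Hp)); auto.
- intros k i Hk Hi; split; [now apply dbl_mono_inv | now apply dbl_mono].
- exact (iter_P Hp).
Qed.

Lemma one_om : succ zero ∈ om.
Proof. exact (succ_om zero_om). Qed.

Definition accept p n : V := answer (app (iter p) n) (succ zero).

Lemma dfnt_accept (t r : (nat -> V) -> V) :
  dfnt t -> dfnt r -> dfnt (fun e => accept (t e) (r e)).
Proof. intros; unfold accept; dfn. Qed.
#[local] Hint Extern 1 (dfnt (fun e => accept _ _)) => simple apply dfnt_accept : dfn.

Section Accept.
Variables (p k n : V).
Hypothesis (Hp : p ∈ P) (Hk : k ∈ om) (D : dom p = dbl k) (Hn : n ∈ om).

Lemma accept_P : accept p n ∈ P.
Proof. unfold accept; apply answer_P; [now apply iter_P | exact one_om]. Qed.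

Lemma sub_accept : included p (accept p n).
Proof. exact (included_trans (sub_iter Hp Hn) (sub_round _ _ _)). Qed.

Lemma dom_accept : dom (accept p n) = dbl (succ (add k n)).
Proof. unfold accept, answer; apply dom_round; [now apply add_om | now apply dom_iter]. Qed.

Lemma dom_accept_lt : dom p ∈ dom (accept p n).
Proof.
assert (K : dom (app (iter p) n) ∈ dom (accept p n)) by (unfold accept, answer; apply dom_round_lt).
assert (Fp := proj1 (proj1 (in_fs _ _) (proj1 (consistentI_fs Hp)))).
assert (Fi := proj1 (proj1 (in_fs _ _) (proj1 (consistentI_fs (iter_P Hp Hn))))).
assert (Fa := proj1 (proj1 (in_fs _ _) (proj1 (consistentI_fs accept_P)))).
destruct (sub_om Fp Fi (dom_sub (sub_iter Hp Hn))) as [-> | L]; auto.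
exact (mem_trans Fa K L).
Qed.

Lemma acc_accept : acc (accept p n) (add k n).
Proof.
assert (F := proj1 (consistentI_fs (iter_P Hp Hn))).
apply (acc_round F (add_om Hk Hn) (dom_iter Hp Hk D Hn) (app_funs Hs F) one_om (add_om Hk Hn)).
right; split; [reflexivity | apply succ_neq_zero].
Qed.

Lemma dec_sub_cov_accept : included (dec (app s (app (iter p) n))) (cov (accept p n)).
Proof.
assert (F := proj1 (consistentI_fs (iter_P Hp Hn))).
intros w Hw.
apply (in_cov_round F (add_om Hk Hn) (dom_iter Hp Hk D Hn) (app_funs Hs F) one_om).
right; split; [apply succ_neq_zero | exact Hw].
Qed.

End Accept.

Definition play z : V := rec P zero (fun k p => accept p (app z k)).

Lemma dfnt_play (t : (nat -> V) -> V) : dfnt t -> dfnt (fun e => play (t e)).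
Proof. intros; unfold play; dfn. Qed.
#[local] Hint Extern 1 (dfnt (fun e => play _)) => simple apply dfnt_play : dfn.

Lemma zero_P : zero ∈ P.
Proof. now apply zero_consistent. Qed.

Section Play.
Variable z : V.
Hypothesis Hz : z ∈ funs om om.

Let step k p : k ∈ om -> p ∈ P -> accept p (app z k) ∈ P.
Proof. intros Hk Hp; apply accept_P; auto; exact (app_funs Hz Hk). Qed.

Lemma play_funs : play z ∈ funs om P.
Proof. apply rec_funs; [dfn | exact zero_P | exact step]. Qed.

Lemma play_zero : app (play z) zero = zero.
Proof.
apply (@rec_zero _ _ P zero (fun k p => accept p (app z k))); [dfn | exact zero_P | exact step].
Qed.

Lemma play_succ k : k ∈ om -> app (play z) (succ k) = accept (app (play z) k) (app z k).
Proof.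
apply (@rec_succ _ _ P zero (fun k p => accept p (app z k))); [dfn | exact zero_P | exact step].
Qed.

Lemma play_P k : k ∈ om -> app (play z) k ∈ P.
Proof. exact (app_funs play_funs). Qed.

Lemma play_funs_fs : play z ∈ funs om (fs om).
Proof. apply (funs_widen play_funs); intros n Hn; now apply consistentI_fs, play_P. Qed.

Lemma play_chain k : k ∈ om -> included (app (play z) k) (app (play z) (succ k)) /\
  dom (app (play z) k) ∈ dom (app (play z) (succ k)).
Proof.
intros Hk; assert (Hp := play_P Hk); assert (Hn := app_funs Hz Hk).
rewrite play_succ by auto; split; [now apply sub_accept | now apply dom_accept_lt].
Qed.

(** Stage zero is the empty position, and every later stage ends with an accepted round. So the
    length of a stage marks where a box begins if nothing is accepted afterwards. *)
Lemma play_last_start k m : k ∈ om -> m ∈ om -> dom (app (play z) k) = dbl m ->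
  forall i, i ∈ om -> m = succ i -> acc (app (play z) k) i.
Proof.
intros Hk Hm D i Hi ->; destruct (om_case Hk) as [-> | [j [Hj ->]]].
- rewrite play_zero, dom_zero, <- dbl_zero in D.
  apply dbl_inj in D; auto using zero_om; symmetry in D; now apply succ_neq_zero in D.
- rewrite play_succ in * by auto.
  assert (Hp := play_P Hj); assert (Hn := app_funs Hz Hj).
  destruct (consistentI_fs Hp) as [_ [l [Hl E]]].
  rewrite (dom_accept Hp Hl E Hn) in D; apply dbl_inj, succ_inj in D;
    auto using succ_om, add_om.
  subst i; now apply acc_accept.
Qed.

Lemma lim_play_funs : lim om (play z) ∈ funs om om.
Proof. exact (lim_funs play_funs_fs play_chain). Qed.

Lemma cov_play_sub k : k ∈ om -> included (cov (app (play z) k)) (cov (lim om (play z))).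
Proof.
intros Hk; apply (cov_mono (chain_fs play_funs_fs Hk) lim_play_funs).
exact (chain_sub_lim play_funs_fs Hk).
Qed.

Lemma play_unbounded : unbounded (lim om (play z)).
Proof.
(* Each stage adds at least one move and a round has two, so [dbl n] stages guarantee [n] rounds.
   The round accepted next then has number at least [n]. *)
intros n Hn; assert (Hd := dbl_om Hn).
assert (Hp := play_P Hd); assert (Hzn := app_funs Hz Hd).
destruct (consistentI_fs Hp) as [_ [l [Hl E]]].
assert (Hln := add_om Hl Hzn).
exists (add l (app z (dbl n))); split; [auto|split].
- intros L.
  assert (M := chain_dom play_funs_fs play_chain Hd); rewrite E in M.
  apply dbl_le_inv in M; auto.
  assert (N := add_ge Hl Hzn).
  assert (K : l ∈ n).
  { apply in_succ in N; destruct N as [N | N].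
    - exact (mem_trans Hn L N).
    - now rewrite N. }
  apply in_succ in M; destruct M as [M | M].
  + exact (mem_asym Hn K M).
  + rewrite M in K; exact (mem_irrefl K).
- assert (A := acc_accept Hp Hl E Hzn); rewrite <- play_succ in A by auto.
  exact (proj1 (acc_mono (chain_fs play_funs_fs (succ_om Hd)) lim_play_funs
    (chain_sub_lim play_funs_fs (succ_om Hd)) Hln A)).
Qed.

Lemma play_wins : cov (lim om (play z)) ∈ C /\ app f (cov (lim om (play z))) ∈ X.
Proof.
assert (K : lim om (play z) ∈ payoff Y H X C f).
{ apply s_wins; [exact lim_play_funs|].
  apply (consistent_lim play_funs_fs play_chain); auto.
  - intros k i Hk Hi; split; [now apply dbl_mono_inv | now apply dbl_mono].
  - exact play_P. }
apply in_payoff in K; destruct K as [_ [K _]]; exact (K play_unbounded).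
Qed.

End Play.

(** The stage [succ i] uses [z] only through its earlier stage and the entry at [i]. Both continuity
    and the common position of siblings rest on this. *)
Lemma play_local z z' : z ∈ funs om om -> z' ∈ funs om om ->
  forall k, k ∈ om -> (forall i, i ∈ k -> app z i = app z' i) ->
  app (play z) k = app (play z') k.
Proof.
intros Hz Hz'; om_induction; [now rewrite !play_zero|].
intros k Hk IH E; rewrite !play_succ, IH, E; auto using mem_succ.
intros i Hi; now apply E, mem_succ_of_mem.
Qed.

(* The plays through [p] that accept next give edges in the box that player I
   builds when player II rejects forever after [p]. *)
Lemma siblings_edge z k h : z ∈ funs om om -> k ∈ om -> h ∈ funs om Y ->
  (forall m, m ∈ om -> exists z', z' ∈ funs om om /\
    (forall i, i ∈ k -> app z i = app z' i) /\ app z' k = m /\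
    app h m = app f (cov (lim om (play z')))) ->
  h ∈ H.
Proof.
intros Hz Hk Hh K; set (p := app (play z) k).
assert (Hp : p ∈ P) by now apply play_P.
destruct (consistentI_fs Hp) as [Fp [l [Hl D]]].
assert (W := rejected_payoff Hp); apply in_payoff in W; destruct W as [_ [_ W]].
(* After [p] nothing is accepted, and [p] is empty or ends with an accepted round. So the box starts
   at round [l], the first one after [p]. *)
apply (W l Hl); auto.
- split.
  + intros i Hi A; destruct (acc_lim (iter_funs_fs Hp) (iter_chain Hp) Hi A) as [n [Hn An]].
    apply (acc_dom Fp D Hl Hi); exact (acc_iter Hp Hl D Hn Hi An).
  + intros i Hi E; assert (A := play_last_start Hz Hk Hl D Hi E).
    apply (acc_mono Fp (lim_funs (iter_funs_fs Hp) (iter_chain Hp))); auto.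
    exact (included_trans (sub_iter Hp zero_om) (chain_sub_lim (iter_funs_fs Hp) zero_om)).
- intros m Hm; destruct (K m Hm) as [z' [Hz' [E [Em Eh]]]].
  exists (cov (lim om (play z'))); split; [now apply play_wins|split; auto].
  (* The move of player I after [m] rejections is made before player II decides about it. Accepting
     it leads into the play of [z'], so the sequence it codes is part of the point produced by that
     play. *)
  assert (Q := iter_P Hp Hm); destruct (consistentI_fs Q) as [FQ _].
  assert (Em' : app (lim om (iter p)) (dbl (add l m)) = app s (app (iter p) m)).
  { rewrite <- (app_ext (chain_fs (iter_funs_fs Hp) (succ_om Hm))
      (lim_funs (iter_funs_fs Hp) (iter_chain Hp))
      (chain_sub_lim (iter_funs_fs Hp) (succ_om Hm))).
    - rewrite iter_succ by auto; unfold answer.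
      exact (app_round_fst FQ (dom_iter Hp Hl D Hm) (app_funs Hs FQ) zero_om).
    - rewrite (dom_iter Hp Hl D (succ_om Hm)), add_succ by auto.
      apply dbl_mono; auto using succ_om, add_om, mem_succ. }
  rewrite Em'; apply (included_trans (dec_sub_cov_accept Hp Hl D Hm)).
  assert (Ep : accept p m = app (play z') (succ k)).
  { rewrite play_succ by auto; unfold p; now rewrite (play_local Hz Hz' Hk E), Em. }
  rewrite Ep; exact (cov_play_sub Hz' (succ_om Hk)).
Qed.

Definition limit_map : V := lam (funs om om) X (fun z => app f (cov (lim om (play z)))).

Let limit_map_dfn : dfnt (fun e : nat -> V => app f (cov (lim om (play (e 0))))).
Proof. dfn. Qed.

Lemma limit_map_funs : limit_map ∈ funs (funs om om) X.
Proof. exact (lam_funs limit_map_dfn (fun z Hz => proj2 (play_wins Hz))). Qed.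

Lemma app_limit_map z : z ∈ funs om om ->
  app limit_map z = app f (cov (lim om (play z))).
Proof. intros Hz; apply (app_lam limit_map_dfn (fun z' Hz' => proj2 (play_wins Hz')) Hz). Qed.

Lemma limit_map_homomorphism :
  homomorphism baire (@baire_dihypergraph V) X (restriction H X) limit_map.
Proof.
split; [apply (is_funE _ baireE (fun x => iff_refl (x ∈ X))), limit_map_funs|].
intros z [t [Ht [Hz K]]]; rewrite finseqE in Ht.
apply (is_funE _ omegaE baireE) in Hz.
assert (Hzn : forall n, n ∈ om -> app z n ∈ funs om om) by (intros; now apply (app_funs Hz)).
assert (Kn : forall n, n ∈ om -> included (snoc t n) (app z n)).
{ intros n Hn; apply (K n (app z n) (snoc t n)); [|now apply is_snoc_snoc].
  now apply mapsE, (app_in_graph Hz). }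
exists (lam om X (fun n => app limit_map (app z n))); split.
{ exact (is_comp_lam Hz limit_map_funs). }
assert (HF : dfnt (fun e : nat -> V => app limit_map (app z (e 0)))) by dfn.
assert (HX : forall n, n ∈ om -> app limit_map (app z n) ∈ X)
  by (intros n Hn; apply (app_funs limit_map_funs); auto).
assert (Hs' := lam_funs HF HX).
assert (Dt := proj1 (proj1 (in_fs _ _) Ht)).
assert (Et : forall n i, n ∈ om -> i ∈ dom t -> app t i = app (app z n) i).
{ intros n i Hn Hi; apply (app_ext Ht (Hzn n Hn)); auto.
  exact (included_trans (@sub_snoc _ _ t n) (Kn n Hn)). }
split.
(* All [app z n] agree below [dom t], so the first of them may represent the common stage. The entry
   of [app z n] at [dom t] is [n], the number of rejections after that stage. *)
- apply (siblings_edge (Hzn zero zero_om) Dt).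
  + apply (funs_widen Hs'); intros n Hn; now apply XY, (app_funs Hs').
  + intros m Hm; exists (app z m); split; [auto|split; [|split]].
    * intros i Hi; now rewrite <- !Et by auto using zero_om.
    * rewrite <- (app_ext (snoc_fs Ht Hm) (Hzn m Hm) (Kn m Hm)).
      -- exact (app_snoc_last Ht Hm).
      -- rewrite dom_snoc; apply mem_succ.
    * now rewrite (app_lam HF HX Hm), app_limit_map by auto.
- now apply (is_funE _ omegaE (fun x => iff_refl (x ∈ X))).
Qed.

(** A finite sequence [t] secures the given open set. All of [t] is covered by some stage [k] of the
    play, and that stage depends only on the first [k] entries of [z]. *)
Lemma limit_map_continuous :
  continuous baire baire_topology (subspace_topology TY X) limit_map.
Proof.
intros O [U [HU HO]].
exists (sep (funs om om) (fun z => app limit_map z ∈ O)).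
assert (E : forall z, z ∈ sep (funs om om) (fun z => app limit_map z ∈ O) <->
  z ∈ funs om om /\ app limit_map z ∈ O)
  by (intros z; apply (@in_sep _ _ _ (fun z => app limit_map z ∈ O)); dfn).
split.
- apply baire_topologyE; split; [intros z Hz; now apply E in Hz|].
  intros z Hz; apply E in Hz; destruct Hz as [Hz Oz].
  rewrite app_limit_map in Oz by auto; apply HO in Oz; destruct Oz as [Uz _].
  destruct (play_wins Hz) as [Cz _].
  destruct (f_continuous HU Cz Uz) as [t [Ht [tz K]]].
  destruct (finite_sub_cov_lim (play_funs_fs Hz) (play_chain Hz) Ht tz) as [k [Hk L]].
  exists (res z k); split; [now apply res_fs|]; split; [apply res_sub|].
  intros z' Hz' zz'; apply E; split; auto; rewrite app_limit_map by auto.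
  destruct (play_wins Hz') as [Cz' Xz']; apply HO; split; [|exact Xz'].
  apply (K _ Cz'), (included_trans L).
  enough (Ek : app (play z) k = app (play z') k) by (rewrite Ek; now apply cov_play_sub).
  apply (play_local Hz Hz' Hk); intros i Hi; assert (Hr := res_fs Hz Hk).
  rewrite <- (app_ext Hr Hz (@res_sub _ _ _ _)), <- (app_ext Hr Hz' zz');
    [reflexivity | |]; now rewrite (dom_res Hz Hk).
- intros z; rewrite E, baireE; split.
  + intros [Hz Oz]; split; auto; exists (app limit_map z); split; auto.
    now apply mapsE, (app_in_graph limit_map_funs).
  + intros [Hz [y [Oy Ey]]]; split; auto; apply mapsE, (funs_maps _ _ limit_map_funs) in Ey.
    now destruct Ey as [_ <-].
Qed.

Theorem first_player_homomorphism : continuous_homomorphism_into TY H X.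
Proof.
exists limit_map; split; [exact limit_map_homomorphism | exact limit_map_continuous].
Qed.
End FirstPlayer.

(** * A winning strategy of player II yields a coloring *)

Section SecondPlayer.
Context {V : set_structure} {HZF : ZF V}.
Hypothesis HDC : DC V.
Variables (Y TY H X C f s : V).
Implicit Types a b c h i k m n p q t u v w x y z A B F : V.
Hypothesis HT : is_topology Y TY.
Hypothesis Hopen : box_open Y TY H.
Hypothesis (Cb : included C (funs om om)).
Hypothesis Hf : f ∈ funs C Y.
Hypothesis XY : included X Y.
Hypothesis f_onto : forall y, y ∈ Y -> exists c, c ∈ C /\ app f c = y.
Hypothesis f_continuous : forall O c, O ∈ TY -> c ∈ C -> app f c ∈ O ->
  exists t, t ∈ fs om /\ included t c /\
    forall c', c' ∈ C -> included t c' -> app f c' ∈ O.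
Hypothesis (Hs : s ∈ funs (fs om) om).
Hypothesis s_wins : forall b, b ∈ funs om om ->
  (forall i, i ∈ om -> app b (succ (dbl i)) = app s (res b (succ (dbl i)))) ->
  ~ b ∈ payoff Y H X C f.

Local Notation P := (consistent s (fun i => succ (dbl i))).

Let dfnt_succ_dbl : dfnt (fun e : nat -> V => succ (dbl (e 0))).
Proof. dfn. Qed.

Lemma consistentII_fs p : p ∈ P -> p ∈ fs om /\ exists k, k ∈ om /\ dom p = dbl k.
Proof. exact (consistent_sub dfnt_succ_dbl). Qed.

Definition reply p a : V := round p a (app s (snoc p a)).

Lemma dfnt_reply (t r : (nat -> V) -> V) :
  dfnt t -> dfnt r -> dfnt (fun e => reply (t e) (r e)).
Proof. intros; unfold reply; dfn. Qed.
#[local] Hint Extern 1 (dfnt (fun e => reply _ _)) => simple apply dfnt_reply : dfn.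

Lemma reply_value p a : p ∈ P -> a ∈ om -> app s (snoc p a) ∈ om.
Proof. intros Hp Ha; apply (app_funs Hs), snoc_fs; auto; now apply consistentII_fs. Qed.

Lemma reply_P p a : p ∈ P -> a ∈ om -> reply p a ∈ P.
Proof.
intros Hp Ha; destruct (consistentII_fs Hp) as [Fp [k [Hk D]]].
assert (Hv := reply_value Hp Ha).
unfold reply; apply (@consistent_round _ _ s (fun i => succ (dbl i)) p k); auto.
{ intros; now apply dbl_lt. }
now rewrite (app_round_snd Fp D Ha Hv), (res_round_snd Fp D Ha Hv).
Qed.

(** The last round of [p] is accepted, or [p] is empty. Then, in any play through [p] that accepts
    nothing further, the box begins right after [p]. *)
Definition ended p : Prop := forall i, i ∈ om -> dom p = dbl (succ i) -> acc p i.

(** The length of [p] says how much of [x] the position [q] has to cover. Since lengths grow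
    strictly, an infinite chain of such steps covers all of [x]. *)
Definition extends x p q : Prop :=
  ended q /\ included p q /\ dom p ∈ dom q /\
  included (res x (dom p)) (cov q) /\ included (cov q) x.

Definition stuck x p : Prop :=
  p ∈ P /\ ended p /\ included (cov p) x /\ ~ exists q, q ∈ P /\ extends x p q.

Lemma dfn_ended (t : (nat -> V) -> V) : dfnt t -> dfn (fun e => ended (t e)).
Proof. intros; unfold ended; dfn. Qed.
#[local] Hint Extern 1 (dfn (fun e => ended _)) => simple apply dfn_ended : dfn.

Lemma dfn_extends (r t u : (nat -> V) -> V) : dfnt r -> dfnt t -> dfnt u ->
  dfn (fun e => extends (r e) (t e) (u e)).
Proof. intros; unfold extends; dfn. Qed.
#[local] Hint Extern 1 (dfn (fun e => extends _ _ _)) => simple apply dfn_extends : dfn.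

Lemma dfn_stuck (r t : (nat -> V) -> V) : dfnt r -> dfnt t ->
  dfn (fun e => stuck (r e) (t e)).
Proof. intros; unfold stuck; dfn. Qed.
#[local] Hint Extern 1 (dfn (fun e => stuck _ _)) => simple apply dfn_stuck : dfn.

Section Chain.
Variables F : V.
Hypothesis HF : F ∈ funs om P.
Hypothesis HS : forall k, k ∈ om -> included (app F k) (app F (succ k)) /\
  dom (app F k) ∈ dom (app F (succ k)).

Lemma chain_funs_fs : F ∈ funs om (fs om).
Proof. apply (funs_widen HF); intros n Hn; exact (proj1 (consistentII_fs (app_funs HF Hn))). Qed.

Lemma chain_not_payoff : ~ lim om F ∈ payoff Y H X C f.
Proof.
apply s_wins; [exact (lim_funs chain_funs_fs HS)|].
apply (consistent_lim chain_funs_fs HS dfnt_succ_dbl).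
- intros k i Hk Hi; split; [now apply dbl_lt_inv | now apply dbl_lt].
- intros n; exact (app_funs HF).
Qed.

Lemma chain_unbounded : (forall n, n ∈ om -> ended (app F n)) -> unbounded (lim om F).
Proof.
(* Stage [dbl (succ n)] has at least [succ n] rounds, and its last round, whose number is at least
   [n], is accepted. *)
intros E n Hn; assert (Hm := dbl_om (succ_om Hn)).
assert (HFm := app_funs HF Hm); destruct (consistentII_fs HFm) as [Fm [l [Hl D]]].
assert (K := chain_dom chain_funs_fs HS Hm); rewrite D in K.
apply dbl_le_inv in K; auto using succ_om.
destruct (om_case Hl) as [-> | [i [Hi ->]]].
- apply in_succ in K; destruct K as [K | K]; [now apply in_zero in K|].
  now apply succ_neq_zero in K.
- exists i; split; [auto|split].
  + intros L; apply succ_mem_succ in L; auto.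
    apply in_succ in K; destruct K as [K | K].
    * exact (mem_asym (succ_om Hi) K L).
    * rewrite K in L; exact (mem_irrefl L).
  + apply (acc_mono Fm (lim_funs chain_funs_fs HS) (chain_sub_lim chain_funs_fs Hm) Hi).
    now apply E.
Qed.

End Chain.

Lemma exists_stuck x : x ∈ C -> app f x ∈ X -> exists p, p ∈ P /\ stuck x p.
Proof.
intros Cx Xx; apply NNPP; intros N.
destruct (@separation _ _ (fun p => ended p /\ included (cov p) x) P) as [A HA]; [dfn|].
unfold is_set_of in HA.
destruct (@dependent_choice _ _ HDC A (extends x)) as [F [HF K]].
{ dfn. }
{ exists zero; apply HA; split; [now apply zero_consistent|split].
  - intros i Hi D; rewrite dom_zero, <- dbl_zero in D.
    apply dbl_inj in D; auto using zero_om, succ_om.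
    symmetry in D; now apply succ_neq_zero in D.
  - rewrite cov_zero; intros w Hw; now apply in_zero in Hw. }
{ intros p Hp; apply HA in Hp; destruct Hp as [Hp [Ep Sp]].
  apply NNPP; intros M; apply N; exists p; split; [auto|].
  repeat split; auto; intros [q [Hq E]]; apply M; exists q; split; auto.
  apply HA; split; [auto|]; split; [apply E | apply E]. }
assert (HFA : forall n, n ∈ om -> app F n ∈ P /\ ended (app F n) /\
  included (cov (app F n)) x).
{ intros n Hn; apply HA, (app_funs HF Hn). }
assert (HF' : F ∈ funs om P) by (apply (funs_widen HF); intros n Hn; now apply HFA).
assert (HS : forall k, k ∈ om -> included (app F k) (app F (succ k)) /\
  dom (app F k) ∈ dom (app F (succ k))).
{ intros k Hk; destruct (K k Hk) as [_ [L [M _]]]; auto. }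
assert (HF0 := chain_funs_fs HF').
assert (U : unbounded (lim om F)).
{ apply (chain_unbounded HF' HS); intros n Hn; now apply HFA. }
assert (E : cov (lim om F) = x).
{ apply set_ext; intros w; split; intros Hw.
  - destruct (cov_lim HF0 HS Hw) as [n [Hn Hw']]; now apply (HFA n Hn).
  - destruct (in_fun (Cb Cx) Hw) as [i [Hi [_ Ew]]].
    (* Stage [succ i] is longer than [i], so the part of [x] that its successor has to cover
       includes the entry at [i]. *)
    assert (L := chain_lt HF0 HS Hi (succ_om Hi) (mem_succ i)).
    destruct (K _ (succ_om Hi)) as [_ [_ [_ [M _]]]].
    apply (cov_mono (chain_fs HF0 (succ_om (succ_om Hi))) (lim_funs HF0 HS)
      (chain_sub_lim HF0 (succ_om (succ_om Hi)))), M, in_res.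
    split; [exact Hw | exists i, (app x i); auto]. }
apply (chain_not_payoff HF' HS), in_payoff; split; [exact (lim_funs HF0 HS)|split].
- rewrite E; auto.
- intros k Hk L; now destruct (last_start_bounded Hk L U).
Qed.

Section Independent.
Variables (p kp h o : V).
Hypothesis (Hp : p ∈ P) (Hkp : kp ∈ om) (D : dom p = dbl kp) (Hh : h ∈ funs om Y).
Hypothesis (Ho : o ∈ funs om TY).
Hypothesis (ho : forall n, n ∈ om -> app h n ∈ app o n).
Hypothesis (oH : forall h', h' ∈ funs om Y ->
  (forall n, n ∈ om -> app h' n ∈ app o n) -> h' ∈ H).
Hypothesis stuck_h : forall n, n ∈ om -> exists x, x ∈ C /\ app f x = app h n /\ stuck x p.

(** The two bounds on [dec m] are chosen so that accepting it would bring about [extends x p]; the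
    last clause keeps the image inside side [n] of the box. The point [x] stays quantified, so only
    an integer has to be selected, and [least] selects it without choice. *)
Definition good n m : Prop := exists x, x ∈ C /\ stuck x p /\
  included (dec m) x /\ included (res x (dom p)) (dec m) /\
  forall c, c ∈ C -> included (dec m) c -> app f c ∈ app o n.

Lemma dfn_good (r t : (nat -> V) -> V) : dfnt r -> dfnt t ->
  dfn (fun e => good (r e) (t e)).
Proof. intros; unfold good; dfn. Qed.
#[local] Hint Extern 1 (dfn (fun e => good _ _)) => simple apply dfn_good : dfn.

Lemma exists_good n : n ∈ om -> exists m, m ∈ om /\ good n m.
Proof.
intros Hn; destruct (stuck_h Hn) as [x [Cx [Ex Sx]]].
destruct (@f_continuous (app o n) x) as [t [Ht [tx K]]]; auto.
{ exact (app_funs Ho Hn). }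
{ rewrite Ex; auto. }
assert (Dp : dom p ∈ om) by (rewrite D; now apply dbl_om).
assert (Hr := res_fs (Cb Cx) Dp).
assert (Dr := dom_res (Cb Cx) Dp).
enough (L : exists r, r ∈ fs om /\ included r x /\ included t r /\
  included (res x (dom p)) r).
{ destruct L as [r [Fr [L1 [L2 L3]]]]; exists (code r); split; [now apply code_om|].
  exists x; rewrite dec_code by auto; split; [auto|]; split; [auto|]; split; [auto|].
  split; [auto|]; intros c Cc rc; apply K; auto; exact (included_trans L2 rc). }
assert (Dt := proj1 (proj1 (in_fs _ _) Ht)).
(* Both [t] and [res x (dom p)] are initial segments of [x]; the longer of them serves as [r]. *)
destruct (mem_total Dp Dt) as [L | L].
- exists (res x (dom p)); split; [auto|]; split; [apply res_sub|].
  split; [|apply included_refl].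
  apply (sub_comparable Ht Hr (Cb Cx) tx (@res_sub _ _ _ _)).
  rewrite Dr; now apply mem_sub.
- exists t; split; [auto|]; split; [auto|]; split; [apply included_refl|].
  apply (sub_comparable Hr Ht (Cb Cx) (@res_sub _ _ _ _) tx); rewrite Dr.
  destruct L as [<- | L]; [apply included_refl | now apply mem_sub].
Qed.

Definition boxes : V := lam om om (fun n => least (good n)).

Let boxes_dfn : dfnt (fun e : nat -> V => least (fun m => good (e 0) m)).
Proof. apply dfnt_least; dfn. Qed.

Lemma least_good n : n ∈ om -> least (good n) ∈ om /\ good n (least (good n)).
Proof. intros Hn; apply least_spec; [dfn | now apply exists_good]. Qed.

Lemma boxes_funs : boxes ∈ funs om om.
Proof. exact (lam_funs boxes_dfn (fun n Hn => proj1 (least_good Hn))). Qed.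

Lemma boxes_good n : n ∈ om -> good n (app boxes n).
Proof.
intros Hn; unfold boxes.
rewrite (app_lam boxes_dfn (fun n Hn => proj1 (least_good Hn)) Hn).
now apply least_good.
Qed.

Definition run : V := rec P p (fun m q => reply q (app boxes m)).

Let step m q : m ∈ om -> q ∈ P -> reply q (app boxes m) ∈ P.
Proof. intros Hm Hq; apply reply_P; auto; exact (app_funs boxes_funs Hm). Qed.

Let run_dfn : dfnt (fun e : nat -> V => reply (e 0) (app boxes (e 1))).
Proof. dfn. Qed.

Lemma run_funs : run ∈ funs om P.
Proof. exact (@rec_funs _ _ P p (fun m q => reply q (app boxes m)) run_dfn Hp step). Qed.

Lemma run_zero : app run zero = p.
Proof. exact (@rec_zero _ _ P p (fun m q => reply q (app boxes m)) run_dfn Hp step). Qed.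

Lemma run_succ m : m ∈ om -> app run (succ m) = reply (app run m) (app boxes m).
Proof. exact (@rec_succ _ _ P p (fun m q => reply q (app boxes m)) run_dfn Hp step m). Qed.

Lemma run_P m : m ∈ om -> app run m ∈ P.
Proof. exact (app_funs run_funs). Qed.

Lemma run_chain k : k ∈ om -> included (app run k) (app run (succ k)) /\
  dom (app run k) ∈ dom (app run (succ k)).
Proof.
intros Hk; rewrite run_succ by auto; unfold reply.
split; [apply sub_round | apply dom_round_lt].
Qed.

Lemma dom_run : forall m, m ∈ om -> dom (app run m) = dbl (add kp m).
Proof.
om_induction; [now rewrite run_zero, add_zero|].
intros m Hm IH; rewrite run_succ, add_succ by auto; unfold reply.
apply dom_round; auto using add_om.
Qed.

Lemma sub_run m : m ∈ om -> included p (app run m).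
Proof.
intros Hm; rewrite <- run_zero at 1.
apply (chain_mono run_chain Hm), zero_mem_succ, Hm.
Qed.

(** As long as nothing has been accepted after [p], accepting the next move would cover exactly
    [cov p] and an initial segment of the point [x] behind that move. The resulting position would
    extend [p] towards [x], but [p] is stuck for [x]. *)
Lemma run_rejected : forall m, m ∈ om -> included (cov (app run m)) (cov p) /\
  forall i, i ∈ om -> acc (app run m) i -> acc p i.
Proof.
om_induction.
{ rewrite run_zero; split; [apply included_refl | auto]. }
intros m Hm [IH1 IH2]; destruct (boxes_good Hm) as [x [Cx [Sx [dx [rd _]]]]].
rewrite run_succ by auto.
assert (Hq := run_P Hm); destruct (consistentII_fs Hq) as [Fq _].
assert (Dq := dom_run Hm); assert (Ha := app_funs boxes_funs Hm).
assert (Hk := add_om Hkp Hm); assert (Hv := reply_value Hq Ha).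
set (q := app run m) in *; set (a := app boxes m) in *.
destruct (classic (app s (snoc q a) = zero)) as [E | E].
- split.
  + intros w Hw; apply (in_cov_round Fq Hk Dq Ha Hv) in Hw.
    destruct Hw as [Hw | [N _]]; [auto | now destruct N].
  + intros i Hi A; apply (acc_round Fq Hk Dq Ha Hv Hi) in A.
    destruct A as [A | [_ N]]; [auto | now destruct N].
- exfalso; destruct Sx as [_ [_ [cx Sx]]]; apply Sx; exists (reply q a).
  split; [now apply reply_P|]; unfold reply; split; [|split; [|split; [|split]]].
  + intros i Hi L; rewrite (dom_round _ _ Hk Dq) in L.
    apply dbl_inj, succ_inj in L; auto using succ_om.
    apply (acc_round Fq Hk Dq Ha Hv Hi); auto.
  + exact (included_trans (sub_run Hm) (sub_round _ _ _)).
  + assert (L := dom_sub (sub_run Hm)).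
    assert (Dp : dom p ∈ om) by (rewrite D; now apply dbl_om).
    assert (Dq' : dom (app run m) ∈ om) by (rewrite dom_run by auto; now apply dbl_om).
    destruct (sub_om Dp Dq' L) as [-> | M]; [apply dom_round_lt|].
    refine (mem_trans _ (dom_round_lt q a _) M).
    now apply (proj1 (in_fs om _)), round_fs.
  + intros w Hw; apply (in_cov_round Fq Hk Dq Ha Hv); right.
    split; [exact E | exact (rd _ Hw)].
  + intros w Hw; apply (in_cov_round Fq Hk Dq Ha Hv) in Hw.
    destruct Hw as [Hw | [_ Hw]]; [exact (cx _ (IH1 _ Hw)) | exact (dx _ Hw)].
Qed.

(** The run obeys the strategy of player II, yet player I wins it: nothing is accepted after [p],
    and the moves made from there on code a box within [o], hence inside [H]. *)
Lemma independent_false : ended p -> False.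
Proof.
intros Ep; apply (chain_not_payoff run_funs run_chain), in_payoff.
assert (HF0 := chain_funs_fs run_funs).
assert (HL := lim_funs HF0 run_chain).
assert (L : last_start (lim om run) kp).
{ split.
  - intros i Hi A; destruct (acc_lim HF0 run_chain Hi A) as [n [Hn An]].
    apply run_rejected in An; auto; exact (acc_dom (proj1 (consistentII_fs Hp)) D Hkp Hi An).
  - intros i Hi E.
    apply (acc_mono (chain_fs HF0 zero_om) HL (chain_sub_lim HF0 zero_om) Hi).
    rewrite run_zero; apply Ep; auto; now rewrite D, E. }
split; [exact HL|split].
- intros U; now destruct (last_start_bounded Hkp L U).
- intros k Hk L'; rewrite (last_start_unique Hk Hkp L' L); intros h' Hh' K.
  apply oH; auto; intros m Hm; destruct (K m Hm) as [c [Cc [dc ->]]].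
  destruct (boxes_good Hm) as [x [_ [_ [_ [_ G]]]]]; apply G; auto.
  enough (E : app (lim om run) (dbl (add kp m)) = app boxes m) by now rewrite <- E.
  assert (Hq := run_P Hm); destruct (consistentII_fs Hq) as [Fq _].
  assert (Ha := app_funs boxes_funs Hm).
  rewrite <- (app_ext (chain_fs HF0 (succ_om Hm)) HL (chain_sub_lim HF0 (succ_om Hm))).
  + rewrite run_succ by auto; unfold reply.
    exact (app_round_fst Fq (dom_run Hm) Ha (reply_value Hq Ha)).
  + rewrite (dom_run (succ_om Hm)), add_succ by auto.
    apply dbl_mono; auto using succ_om, add_om, mem_succ.
Qed.

End Independent.

Lemma stuck_independent p h : h ∈ H ->
  ~ forall n, n ∈ om -> exists x, x ∈ C /\ app f x = app h n /\ stuck x p.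
Proof.
intros Hh K.
destruct (box_open_local HT Hopen Hh) as [o [Ho [ho oH]]].
destruct (K zero zero_om) as [x [_ [_ [Hp [Ep _]]]]].
destruct (consistentII_fs Hp) as [_ [kp [Hkp D]]].
exact (independent_false Hp Hkp D Ho ho oH K Ep).
Qed.

(** A point may have many preimages, stuck at different positions. The least code over all of them
    gives a definable value. *)
Definition color y : V :=
  least (fun m => exists x, x ∈ C /\ app f x = y /\ stuck x (dec m)).

Let color_dfn : dfnt (fun e : nat -> V => color (e 0)).
Proof. unfold color; dfn. Qed.

Lemma color_spec y : y ∈ X ->
  color y ∈ om /\ exists x, x ∈ C /\ app f x = y /\ stuck x (dec (color y)).
Proof.
intros Xy; unfold color; apply (@least_spec _ _ (fun m =>
  exists x, x ∈ C /\ app f x = y /\ stuck x (dec m))); [dfn|].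
destruct (f_onto (XY Xy)) as [x [Cx Ex]].
destruct (@exists_stuck x Cx) as [p [Hp Sp]]; [now rewrite Ex|].
destruct (consistentII_fs Hp) as [Fp _].
exists (code p); split; [now apply code_om|]; exists x; rewrite dec_code; auto.
Qed.

Theorem second_player_coloring : aleph0_colorable X (restriction H X).
Proof.
assert (Did : dfnt (fun e : nat -> V => e 0)) by dfn.
assert (Hid : forall x, x ∈ om -> x ∈ om) by auto.
assert (Hi := lam_funs Did Hid).
assert (Hc := lam_funs color_dfn (fun y Hy => proj1 (color_spec Hy))).
exists om, (lam X om color); split; [|split].
- exists (lam om om (fun x => x)); split; [|split].
  + now apply (is_funE _ omegaE (fun x => iff_refl (x ∈ om))).
  + intros x x' y Hx Hx'; rewrite !mapsE, !(funs_maps _ _ Hi).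
    intros [Ox ->] [Ox' E]; now rewrite !(app_lam Did Hid) in E by auto.
  + intros y Hy; exists y; rewrite omegaE, mapsE, (funs_maps _ _ Hi).
    now rewrite (app_lam Did Hid).
- now apply (is_funE _ (fun x => iff_refl (x ∈ X)) (fun x => iff_refl (x ∈ om))).
- intros z [Hz Xz]; apply (is_funE _ omegaE (fun x => iff_refl (x ∈ X))) in Xz.
  exists (lam om om (fun n => app (lam X om color) (app z n))); split.
  { exact (is_comp_lam Xz Hc). }
  assert (DF : dfnt (fun e : nat -> V => app (lam X om color) (app z (e 0)))) by dfn.
  assert (HF : forall n, n ∈ om -> app (lam X om color) (app z n) ∈ om)
    by (intros n Hn; exact (app_funs Hc (app_funs Xz Hn))).
  assert (HL := lam_funs DF HF); split.
  { now apply (is_funE _ omegaE (fun x => iff_refl (x ∈ om))). }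
  (* A constant colour [k] would give every vertex of the edge a preimage stuck at the one position
     [dec k]. *)
  intros [k K]; apply (@stuck_independent (dec k) z Hz); intros n Hn.
  assert (E : k = color (app z n)).
  { rewrite <- (app_lam color_dfn (fun y Hy => proj1 (color_spec Hy)) (app_funs Xz Hn)).
    rewrite <- (app_lam DF HF Hn); apply (funs_maps _ _ HL), mapsE, K; now apply omegaE. }
  rewrite E; now apply color_spec, (app_funs Xz).
Qed.

End SecondPlayer.

(** * The two alternatives *)

Section Exclusion.
Context {V : set_structure} {HZF : ZF V}.
Hypothesis HDC : DC V.
Variables (H X : V).
Implicit Types a b c h i k m n p q t u v w x y z A B F : V.

Lemma comp_maps h g f x y z : is_comp h g f -> maps f x y -> maps g y z -> maps h x z.
Proof.
intros Hh Hf Hg; apply mapsE, Hh; exists x, y, z; now rewrite is_opairE.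
Qed.

Lemma is_snocE t' t n : is_snoc t' t n -> t' = snoc t n.
Proof.
intros [k [p [Ht [Hp H']]]]; apply finseq_of_lengthE in Ht; apply is_opairE in Hp.
destruct Ht as [_ <-]; subst p; apply set_ext; intros w; now rewrite (H' w), in_snoc.
Qed.

Section Coloring.
Variables (C g c f : V).
Hypothesis (Hg : g ∈ funs om C) (g_onto : forall y, y ∈ C -> exists k, k ∈ om /\ y = app g k).
Hypothesis (Hc : c ∈ funs X C) (Hf : f ∈ funs (funs om om) X).
Hypothesis Hcol : homomorphism X (restriction H X) C (complete_dihypergraph C) c.
Hypothesis Hhom : homomorphism baire (@baire_dihypergraph V) X (restriction H X) f.

Definition avoids k t : Prop := forall b, b ∈ funs om om -> included t b ->
  app c (app f b) <> app g k.

Lemma dfn_avoids (r t : (nat -> V) -> V) : dfnt r -> dfnt t ->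
  dfn (fun e => avoids (r e) (t e)).
Proof. intros; unfold avoids; dfn. Qed.
#[local] Hint Extern 1 (dfn (fun e => avoids _ _)) => simple apply dfn_avoids : dfn.

(** Otherwise each child of [t] has a branch of colour [app g k]. The sequence of these branches is
    an edge because of [t], so its image is an edge of [H] in [X] on which [c] is constant. *)
Lemma exists_avoids k t : k ∈ om -> t ∈ fs om ->
  exists n, n ∈ om /\ avoids k (snoc t n).
Proof.
intros Hk Ht; apply NNPP; intros N.
destruct (@countable_choice _ _ HDC (funs om om)
  (fun n b => included (snoc t n) b /\ app c (app f b) = app g k)) as [z [Hz K]].
{ dfn. }
{ intros n Hn; apply NNPP; intros M; apply N; exists n; split; auto.
  intros b Hb tb E; apply M; exists b; auto. }
destruct (proj2 Hhom z) as [h [hc [Hh Xh]]].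
{ exists t; split; [now apply finseqE|]; split; [now apply (is_funE _ omegaE baireE)|].
  intros n b t' zb Et'; apply is_snocE in Et'; subst t'; apply cylinderE.
  apply mapsE, (funs_maps _ _ Hz) in zb; destruct zb as [Hn ->].
  split; [exact (app_funs Hz Hn) | now apply K]. }
destruct (proj2 Hcol h (conj Hh Xh)) as [d [dc [_ Hd]]]; apply Hd.
exists (app g k); intros n Hn; rewrite omegaE in Hn.
assert (Hzn := app_funs Hz Hn).
rewrite <- (proj2 (K n Hn)); apply (comp_maps dc (y := app f (app z n))).
- apply (comp_maps hc (y := app z n)); apply mapsE.
  + exact (app_in_graph Hz Hn).
  + exact (app_in_graph Hf Hzn).
- apply mapsE, (app_in_graph Hc), (app_funs Hf), Hzn.
Qed.

Definition diagonal : V :=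
  rec (fs om) zero (fun k t => snoc t (least (fun n => avoids k (snoc t n)))).

Let diagonal_dfn : dfnt (fun e : nat -> V =>
  snoc (e 0) (least (fun n => avoids (e 1) (snoc (e 0) n)))).
Proof. dfn. Qed.

Lemma least_avoids k t : k ∈ om -> t ∈ fs om ->
  least (fun n => avoids k (snoc t n)) ∈ om /\
  avoids k (snoc t (least (fun n => avoids k (snoc t n)))).
Proof.
intros Hk Ht; apply (@least_spec _ _ (fun n => avoids k (snoc t n))); [dfn|].
now apply exists_avoids.
Qed.

Let step k t : k ∈ om -> t ∈ fs om ->
  snoc t (least (fun n => avoids k (snoc t n))) ∈ fs om.
Proof. intros Hk Ht; apply snoc_fs; auto; now apply least_avoids. Qed.

Lemma no_coloring : False.
Proof.
assert (HF := @rec_funs _ _ (fs om) zero _ diagonal_dfn (zero_fs om) step).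
assert (HS := @rec_succ _ _ (fs om) zero _ diagonal_dfn (zero_fs om) step).
fold diagonal in HF, HS.
assert (HC : forall k, k ∈ om -> included (app diagonal k) (app diagonal (succ k)) /\
  dom (app diagonal k) ∈ dom (app diagonal (succ k))).
{ intros k Hk; rewrite (HS k Hk), dom_snoc; split; [apply sub_snoc | apply mem_succ]. }
assert (Hb := lim_funs HF HC).
destruct (g_onto (app_funs Hc (app_funs Hf Hb))) as [k [Hk E]].
(* The limit passes through stage [succ k], where the colour [app g k] is avoided, although this is
   its own colour. *)
apply (least_avoids Hk (app_funs HF Hk)) with (b := lim om diagonal); auto.
rewrite <- (HS k Hk); exact (chain_sub_lim HF (succ_om Hk)).
Qed.

End Coloring.

Theorem colorable_homomorphism_exclusive TY :
  ~ (aleph0_colorable X (restriction H X) /\ continuous_homomorphism_into TY H X).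
Proof.
intros [[C [c [[g [Hg [_ Og]]] Hc]]] [f [Hf _]]].
assert (iffr : forall A x : V, elements A x <-> x ∈ A) by reflexivity.
assert (Fg : g ∈ funs om C) by now apply (is_funE _ omegaE (iffr C)).
assert (Fc : c ∈ funs X C) by (destruct Hc; now apply (is_funE _ (iffr X) (iffr C))).
assert (Ff : f ∈ funs (funs om om) X) by (destruct Hf; now apply (is_funE _ baireE (iffr X))).
refine (no_coloring _ Fc Ff Hc Hf).
intros y Hy; destruct (Og y Hy) as [k [Hk K]]; exists k; rewrite mapsE in K.
now apply (funs_maps _ _ Fg) in K.
Qed.

End Exclusion.

(** * Determinacy applied to the payoff set *)

Section Dichotomy.
Context {V : set_structure} {HZF : ZF V}.
Hypothesis (HDC : DC V) (HAD : AD V).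

Theorem box_open_dichotomy (Y TY H X : V) :
  is_topology Y TY -> analytic Y TY -> dihypergraph H Y -> box_open Y TY H ->
  included X Y ->
  aleph0_colorable X (restriction H X) \/ continuous_homomorphism_into TY H X.
Proof.
intros HT [C [f [[HC _] [Hf [Of Cf]]]]] HH Hopen XY.
assert (iffr : forall A x : V, elements A x <-> x ∈ A) by reflexivity.
assert (Cb : included C (funs om om)) by (intros x Hx; now apply baireE, HC).
apply (is_funE _ (iffr C) (iffr Y)) in Hf.
assert (f_onto : forall y, y ∈ Y -> exists c, c ∈ C /\ app f c = y).
{ intros y Hy; destruct (Of y Hy) as [c [Hc K]]; exists c; split; auto.
  now apply mapsE, (funs_maps _ _ Hf) in K. }
(* Continuity in terms of finite initial segments, the information about a point that the moves of
   the game convey. *)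
assert (f_continuous : forall O c, O ∈ TY -> c ∈ C -> app f c ∈ O ->
  exists t, t ∈ fs om /\ included t c /\
    forall c', c' ∈ C -> included t c' -> app f c' ∈ O).
{ intros O c HO Hc Oc; destruct (Cf O HO) as [P [[U [HU HP]] HPf]].
  assert (Uc : c ∈ U).
  { apply HP, HPf; split; auto; exists (app f c); split; auto.
    now apply mapsE, (app_in_graph Hf). }
  apply baire_topologyE in HU; destruct (proj2 HU c Uc) as [t [Ht [tc K]]].
  exists t; split; [auto|split; [auto|]]; intros c' Hc' tc'.
  assert (Pc : c' ∈ P) by (apply HP; split; [exact (K c' (Cb _ Hc') tc') | exact Hc']).
  apply HPf in Pc; destruct Pc as [_ [y [Oy Ey]]].
  apply mapsE, (funs_maps _ _ Hf) in Ey; now destruct Ey as [_ <-]. }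
destruct (HAD (A := payoff Y H X C f)) as [[s [Hs W]] | [s [Hs W]]].
{ intros b Hb; apply baireE; now apply in_payoff in Hb. }
- apply is_strategyE in Hs; right; apply (first_player_homomorphism XY f_continuous Hs).
  intros b Hb K; apply W; [now apply baireE|]; intros n Hn.
  apply evenE in Hn; destruct Hn as [m [Hm ->]]; apply obeys_atE; auto using dbl_om.
- apply is_strategyE in Hs; left.
  apply (second_player_coloring HDC HT Hopen Cb XY f_onto f_continuous Hs).
  intros b Hb K; apply W; [now apply baireE|]; intros n Hn.
  apply oddE in Hn; destruct Hn as [m [Hm ->]]; apply obeys_atE;
    auto using succ_om, dbl_om.
Qed.

End Dichotomy.

Theorem theorem1p3 :
  forall V : set_structure, ZF V -> DC V -> AD V ->
  forall Y TY H X : V,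
    is_topology Y TY -> hausdorff Y TY -> analytic Y TY ->
    dihypergraph H Y -> box_open Y TY H ->
    included X Y ->
    (aleph0_colorable X (restriction H X) \/ continuous_homomorphism_into TY H X) /\
    ~ (aleph0_colorable X (restriction H X) /\ continuous_homomorphism_into TY H X).
Proof.
intros V HZF HDC HAD Y TY H X HT _ HY HH Hopen XY; split.
- now apply box_open_dichotomy with (Y := Y).
- now apply colorable_homomorphism_exclusive.
Qed.
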